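(* Let $A\in\mathrm{Mat}_{m,n}$ and let $\psi:\mathbb R_+\to\mathbb R_+$ be continuous, strictly decreasing, lower quasimultiplicative, and tend to zero at infinity. (i) The limits $$P_-(A,\psi):=\lim_{L\to\infty}\inf_{c>0}\mathcal P_{A,\psi}(L,c),\qquad P_+(A,\psi):=\lim_{L\to\infty}\sup_{c>0}\mathcal P_{A,\psi}(L,c)$$ exist. One has $$\dim_H \mathrm{Sing}_A(\psi)=\inf_{c>0}\dim_H D_A(c\psi)=P_-(A,\psi)$$ and $$\dim_H U_A(\psi)=\sup_{c>0}\dim_H D_A(c\psi)=P_+(A,\psi).$$ (ii) The quantity $\dim_H D_A(c\psi)$ is independent of $c>0$ if and only if $P_-(A,\psi)=P_+(A,\psi)$. Under this condition, $$\dim_H D_A(\psi)=\dim_H\mathrm{Sing}_A(\psi)=\dim_H U_A(\psi)=P_-(A,\psi)=P_+(A,\psi)=\lim_{L\to\infty}\mathcal P_{A,\psi}(L,1).$$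
   Context: Let $m,n\in\mathbb N$, $d=m+n$, $\mathbb R_+=(0,\infty)$, and let $\mathrm{Mat}_{m,n}$ be the set of real $m\times n$ matrices. $|\cdot|$ is the supremum norm. $\mathbb T^m=\mathbb R^m/\mathbb Z^m$ carries the quotient supremum metric, and $\dim_H$ is Hausdorff dimension. For a function $\psi:\mathbb R_+\to\mathbb R_+$, $D_A(\psi)$ is the set of $\mathbf b\in\mathbb T^m$ such that for every sufficiently large real $T$ there is $(\mathbf p,\mathbf q)\in\mathbb Z^m\times\mathbb Z^n$ with $|A\mathbf q-\mathbf p-\mathbf b|\le\psi(T)$ and $|\mathbf q|\le T$. For $c>0$, $c\psi$ is the function $T\mapsto c\psi(T)$. A decreasing function $\psi$ is lower quasimultiplicative if there exist $0<\tau<\infty$ and $R_0>1$ such that $R^{-\tau}\psi(T)\le\psi(RT)$ for every sufficiently large $T$ and every $R\ge R_0$. For lower quasimultiplicative $\psi$: $\mathrm{Sing}_A(\psi):=\bigcap_{c>0}D_A(c\psi)$ and $U_A(\psi):=\bigcup_{c>0}D_A(c\psi)$. Standing normalization (harmless since changing $\psi$ on a bounded interval does not affect the sets): $\psi(T)\to\infty$ as $T\to0$, so that $\psi$ has an inverse on $\mathbb R_+$. Lattice data: $u_A=\begin{pmatrix}I_m&A\\0&I_n\end{pmatrix}$, $a_t=\mathrm{diag}(e^{t/m}I_m,e^{-t/n}I_n)$. For a lattice $\Lambda\subset\mathbb R^d$, $\lambda_i(\Lambda)$ is its $i$-th successive minimum relative to $[-1,1]^d$ (the infimum of $\lambda>0$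 such that $\lambda[-1,1]^d\cap\Lambda$ contains $i$ linearly independent vectors), and $\lambda_i(t):=\lambda_i(a_tu_A\mathbb Z^d)$. For $R,Q>0$ put $$t_{R,Q}:=\frac{mn}{d}\log\frac QR,\qquad \mathcal N_A(R,Q):=\prod_{i=1}^d\max\left\{\frac{Q^{n/d}R^{m/d}}{\lambda_i(t_{R,Q})},1\right\}.$$ For $L>0$ let $T_j:=\psi^{-1}(e^{-jL})$, $j\ge0$. For $L,c>0$, $$\mathcal P_{A,\psi}(L,c):=\liminf_{N\to\infty}\frac1{NL}\sum_{j=0}^{N-1}\log\frac{\mathcal N_A(c\psi(T_j),T_{j+1})}{\mathcal N_A(c\psi(T_{j+1}),T_{j+1})}.$$ *)

(* Defs.v *)
From HB Require Import structures.
From mathcomp Require Import all_boot all_order all_algebra.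
From mathcomp Require Import all_classical all_reals all_analysis.

Set Implicit Arguments.
Unset Strict Implicit.
Unset Printing Implicit Defensive.

Import Order.TTheory GRing.Theory Num.Theory.
Import numFieldNormedType.Exports.

Local Open Scope classical_set_scope.
Local Open Scope ring_scope.
Local Open Scope quotient_scope.

(* On matrices, [`|x|] is the library's norm [mx_norm], the maximum of the
   absolute values of the entries. *)

Section hausdorff_dimension.
Context {R : realType} {T : metricType R}.
Implicit Types (E : set T) (s delta : R).

(* [-oo] on the empty set *)
Definition diam E : \bar R :=
  ereal_sup [set (mdist x.1 x.2)%:E | x in E `*` E].

(* The case distinction only matters for s = 0, where [poweR] follows the
   convention 0 ^ 0 = 1 while the empty set has to weigh 0. *)
Definition diam_pow s E : \bar R :=
  if E == set0 then 0%E else poweR (diam E) s.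

Definition hausdorff_premeasure s delta E : \bar R :=
  ereal_inf [set (\sum_(0 <= i <oo) diam_pow s (U i))%E
            | U in [set U : nat -> set T |
                E `<=` \bigcup_i U i /\
                forall i, (diam (U i) <= delta%:E)%E]].

Definition hausdorff_measure s E : \bar R :=
  ereal_sup [set hausdorff_premeasure s delta E | delta in [set d : R | 0 < d]].

Definition hausdorff_dim E : \bar R :=
  ereal_inf [set s%:E | s in [set s : R | 0 <= s /\ hausdorff_measure s E = 0%E]].

End hausdorff_dimension.

Definition intmx {R : realType} {m n : nat} (p : 'M[int]_(m, n)) : 'M[R]_(m, n) :=
  map_mx intr p.

Section torus.
Context {R : realType} {m : nat}.
Implicit Types x y z : 'cV[R]_m.

Definition torus_equiv x y := (x - y) \is a mxOver Num.int.

Lemma torus_equivP x y :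
  reflect (exists p, x - y = intmx p) (torus_equiv x y).
Proof.
apply: (iffP mxOverP) => [h|[p ->] i j]; last by rewrite mxE intr_int.
exists (map_mx Num.floor (x - y)); apply/matrixP => i j.
by have := h i j; rewrite !mxE => hij; rewrite floorK.
Qed.

Lemma torus_equiv_is_equiv : equiv_class_of torus_equiv.
Proof.
split=> [x|x y|y x z].
- by apply/torus_equivP; exists 0; rewrite subrr /intmx map_mx0.
- have sym u v : torus_equiv u v -> torus_equiv v u.
    case/torus_equivP=> p uv; apply/torus_equivP; exists (- p).
    by rewrite -opprB uv /intmx map_mxN.
  by apply/idP/idP; exact: sym.
- case/torus_equivP=> p xy; case/torus_equivP=> q yz.
  by apply/torus_equivP; exists (p + q); rewrite -(subrKA y) xy yz /intmx map_mxD.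
Qed.

Canonical torus_equiv_equiv := EquivRelPack torus_equiv_is_equiv.

End torus.

Definition torus (R : realType) (m : nat) : Type :=
  {eq_quot (@torus_equiv R m)}.

HB.instance Definition _ (R : realType) (m : nat) := Choice.on (torus R m).
HB.instance Definition _ (R : realType) (m : nat) :=
  EqQuotient.on (torus R m).

Section torus_metric.
Context {R : realType} {m : nat}.
Implicit Types x y z : torus R m.

Let dists x y : set R :=
  [set `|repr x - repr y - intmx p| | p in [set: 'cV[int]_m]].

Definition torus_dist x y : R := inf (dists x y).

Let dists_neq0 x y : dists x y !=set0.
Proof. by exists `|repr x - repr y - intmx 0|; exists 0. Qed.

Let dists_inf x y : has_inf (dists x y).
Proof. by split; [exact: dists_neq0 | exists 0 => _ [p _ <-]]. Qed.

Let torus_dist_le x y p : torus_dist x y <= `|repr x - repr y - intmx p|.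
Proof. by apply: ge_inf; [case: (dists_inf x y) | exists p]. Qed.

Let torus_dist_lt x y e : torus_dist x y < e ->
  exists p, `|repr x - repr y - intmx p| < e.
Proof.
move=> h; have e0 : 0 < e - torus_dist x y by rewrite subr_gt0.
have [_ [p _ <-]] := inf_adherent e0 (dists_inf x y).
by rewrite -/(torus_dist x y) subrKC => ?; exists p.
Qed.

Let torus_dist_ge0 x y : 0 <= torus_dist x y.
Proof. by apply: lb_le_inf => // _ [p _ <-]. Qed.

Lemma torus_distxx x : torus_dist x x = 0.
Proof.
apply/eqP; rewrite eq_le torus_dist_ge0 andbT.
apply: le_trans (torus_dist_le x x 0) _.
by rewrite /intmx map_mx0 !subrr normr0.
Qed.

Lemma torus_dist_sym x y : torus_dist x y = torus_dist y x.
Proof.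
have le u v : torus_dist u v <= torus_dist v u.
  apply: lb_le_inf => // _ [p _ <-].
  apply: le_trans (torus_dist_le u v (- p)) _.
  by rewrite /intmx map_mxN -normrN !opprD !opprK (addrC (- _)).
by apply/eqP; rewrite eq_le !le.
Qed.

Lemma torus_dist_triangle y x z :
  torus_dist x z <= torus_dist x y + torus_dist y z.
Proof.
apply/ler_addgt0Pl => e e0.
have e2 : 0 < e / 2 by rewrite divr_gt0.
have [p hp] : exists p,
    `|repr x - repr y - intmx p| < torus_dist x y + e / 2.
  by apply: torus_dist_lt; rewrite ltrDl.
have [q hq] : exists q,
    `|repr y - repr z - intmx q| < torus_dist y z + e / 2.
  by apply: torus_dist_lt; rewrite ltrDl.
apply: le_trans (torus_dist_le x z (p + q)) _.
have -> : repr x - repr z - intmx (p + q) =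
    (repr x - repr y - intmx p) + (repr y - repr z - intmx q).
  by rewrite /intmx map_mxD opprD [RHS]addrACA subrKA.
apply: le_trans (ler_normD _ _) _.
apply: le_trans (lerD (ltW hp) (ltW hq)) _.
by rewrite addrACA -splitr addrC.
Qed.

Lemma torus_dist_positivity x y : torus_dist x y = 0 -> x = y.
Proof.
move=> xy0.
have near0 e : 0 < e -> exists p, `|repr x - repr y - intmx p| < e.
  by move=> e0; apply: torus_dist_lt; rewrite xy0.
have [p hp] := near0 2^-1 ltac:(by rewrite invr_gt0).
suff : `|repr x - repr y - intmx p| <= 0.
  rewrite normr_le0 subr_eq0 => /eqP h.
  rewrite -[x]reprK -[y]reprK; apply/eqP; rewrite eqmodE.
  by apply/torus_equivP; exists p.
apply/ler_addgt0Pl => e e0; rewrite addr0.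
have [q] := near0 (Num.min e 2^-1) ltac:(by rewrite lt_min e0 invr_gt0 /=).
rewrite lt_min => /andP[qe hq].
suff -> : p = q by exact: ltW.
apply/matrixP => i j.
have lt1 : `|(intmx q - intmx p : 'cV[R]_m)| < 1.
  have -> : intmx q - intmx p = (repr x - repr y - intmx p)
                              - (repr x - repr y - intmx q).
    by rewrite opprB [RHS]addrC subrKA.
  apply: le_lt_trans (ler_normB _ _) _.
  by rewrite [ltRHS](splitr 1) !div1r ltrD.
have {lt1} : `|(q i j - p i j)%:~R| < (1 : R).
  apply: le_lt_trans lt1; rewrite [leRHS]/Num.norm/= mx_normrE.
  have -> : (q i j - p i j)%:~R = (intmx q - intmx p : 'cV[R]_m) i j.
    by rewrite !mxE rmorphB.
  exact: (le_bigmax _ (fun ij => `|(intmx q - intmx p : 'cV[R]_m) ij.1 ij.2|)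
            (i, j)).
by rewrite -intr_norm ltrz1 -[1]add0r ltzD1 normr_le0 subr_eq0 => /eqP.
Qed.

HB.instance Definition _ := isMetric.Build R (torus R m)
  torus_distxx torus_dist_positivity torus_dist_sym torus_dist_triangle.

End torus_metric.

Section approximation.
Context {R : realType} {m n : nat}.
Implicit Types (A : 'M[R]_(m, n)) (psi : R -> R) (c : R).

(* As p runs over all integer vectors, the choice of the representative of b
   does not matter. *)
Definition D A psi : set (torus R m) :=
  [set b | \forall T \near +oo, exists (p : 'cV[int]_m) (q : 'cV[int]_n),
     `|A *m intmx q - intmx p - repr b| <= psi T /\
     `|intmx q : 'cV[R]_n| <= T].

Definition scale c psi : R -> R := fun T => c * psi T.

Definition Sing A psi : set (torus R m) :=
  \bigcap_(c in [set c : R | 0 < c]) D A (scale c psi).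

Definition U A psi : set (torus R m) :=
  \bigcup_(c in [set c : R | 0 < c]) D A (scale c psi).

End approximation.

Definition lower_quasimultiplicative {R : realType} (psi : R -> R) : Prop :=
  exists tau R0 : R, [/\ 0 < tau, 1 < R0 &
    \forall T \near +oo, forall r, R0 <= r ->
      r `^ (- tau) * psi T <= psi (r * T)].

Definition successive_min {R : realType} {d : nat} (Lam : set 'cV[R]_d)
    (i : nat) : R :=
  inf [set l : R | 0 < l /\
    exists v : i.-tuple 'cV[R]_d, free v /\
      forall x, x \in v -> Lam x /\ `|x| <= l].

Section pressure.
Context {R : realType} {m n : nat}.
Implicit Types (A : 'M[R]_(m, n)) (psi : R -> R) (c L t r Q : R).

Definition umx A : 'M[R]_(m + n) := block_mx 1%:M A 0 1%:M.

Definition amx t : 'M[R]_(m + n) :=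
  block_mx (expR (t / m%:R))%:M 0 0 (expR (- t / n%:R))%:M.

Definition lattice A t : set 'cV[R]_(m + n) :=
  [set amx t *m umx A *m intmx z | z in [set: 'cV[int]_(m + n)]].

Definition flow_time r Q : R :=
  (m * n)%:R / (m + n)%:R * ln (Q / r).

(* Successive minima are indexed from 1. *)
Definition Nprod A r Q : R :=
  \prod_(i < m + n)
    Num.max (Q `^ (n%:R / (m + n)%:R) * r `^ (m%:R / (m + n)%:R) /
             successive_min (lattice A (flow_time r Q)) i.+1) 1.

Definition Tseq psi L (j : nat) : R :=
  pinv [set T : R | 0 < T] psi (expR (- (j%:R * L))).

Definition pressure A psi L c : \bar R :=
  limn_einf (fun N : nat => ((N%:R * L)^-1 * \sum_(0 <= j < N)
    ln (Nprod A (c * psi (Tseq psi L j)) (Tseq psi L j.+1) /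
        Nprod A (c * psi (Tseq psi L j.+1)) (Tseq psi L j.+1)))%:E).

Definition inf_pressure A psi L : \bar R :=
  ereal_inf [set pressure A psi L c | c in [set c : R | 0 < c]].

Definition sup_pressure A psi L : \bar R :=
  ereal_sup [set pressure A psi L c | c in [set c : R | 0 < c]].

Definition Pminus A psi : \bar R := lim (inf_pressure A psi L @[L --> +oo]).

Definition Pplus A psi : \bar R := lim (sup_pressure A psi L @[L --> +oo]).

End pressure.

(* Main.v *)
(** The number of integer points z = (p, q) with |A q + p| <= r, |q| <= Q is
    comparable, up to a constant K depending only on m + n, with Nprod A r Q:
    the lower bound counts small integer combinations of vectors realizing the
    successive minima, the upper bound separates the points by residues modulo
    decreasing powers of 2 in a triangular basis adapted to the minima.

    Write r_j = psi T_j = e^(-jL).  Up to replacing c by c e^(-L), a point b is in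
    D (c psi) iff for all large j it is within c r_j of some A q - p, |q| <= T_j.
    Near a point of level j, the points of level j+1 occupy about
    Nprod (c r_j) T_(j+1) / Nprod (c r_(j+1)) T_(j+1) places at scale r_(j+1), up to
    a factor K.  Covering level by level gives
    dim D (c psi) <= P(L, c) + ln K / L, and a homogeneous Cantor set built from
    maximal separated sets gives P(L, c e^(-L)) <= dim D (c psi) + 2 ln K / L; lower
    quasimultiplicativity is used to get 2 T_j <= T_(j+1).  The lower bound on the
    dimension of the Cantor set needs no measure: if a cover had small total
    weight, a greedy descent in the tree would produce a point avoiding it.

    Letting L tend to infinity identifies the limits of the infimum and supremum
    over c.  The set U is a countable union of sets D (c psi); for Sing one runs
    the Cantor construction with c = c_j tending to 0 so slowly (halving at times
    whose sum is at most 2 N up to time N) that the averages change only by O(1 / L). *)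

Require Import Defs.
From HB Require Import structures.
From mathcomp Require Import all_boot all_order all_algebra finmap.
From mathcomp Require Import all_classical all_reals all_analysis.
From mathcomp Require Import zify ring lra.

Set Implicit Arguments.
Unset Strict Implicit.
Unset Printing Implicit Defensive.

Import Order.TTheory GRing.Theory Num.Theory.
Import numFieldNormedType.Exports.

Local Open Scope classical_set_scope.
Local Open Scope ring_scope.

(** * Counting lattice points by successive minima *)

Lemma cv_norm_leP (R : realType) d (x : 'cV[R]_d) (r : R) : 0 <= r ->
  (`|x| <= r) <-> (forall i, `|x i 0| <= r).
Proof.
move=> r0; rewrite [X in X <= _]/Num.norm /= mx_normrE; split.
  move=> h i; apply: le_trans h.
  exact: (le_bigmax _ (fun ij : 'I_d * 'I_1 => `|x ij.1 ij.2|) (i, ord0)).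
move=> h; apply/bigmax_leP; split => // -[i j] _ /=.
by rewrite (ord1 j).
Qed.

Lemma cv_norm_ge (R : realType) d (x : 'cV[R]_d) i : `|x i 0| <= `|x|.
Proof. by move: i; apply/cv_norm_leP. Qed.

Lemma intmxD (R : realType) m n (x y : 'M[int]_(m, n)) :
  intmx (x + y) = intmx x + intmx y :> 'M[R]_(m, n).
Proof. by rewrite /intmx map_mxD. Qed.

Lemma intmxN (R : realType) m n (x : 'M[int]_(m, n)) :
  intmx (- x) = - intmx x :> 'M[R]_(m, n).
Proof. by rewrite /intmx map_mxN. Qed.

Lemma intmx0 (R : realType) m n : intmx 0 = 0 :> 'M[R]_(m, n).
Proof. by rewrite /intmx map_mx0. Qed.

(* Column-style Hermite normal form, by Smith reduction of the first column. *)
Lemma unimodular_triangular d (Z : 'M[int]_d) :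
  exists2 U : 'M[int]_d, U \in unitmx &
    forall i j : 'I_d, (j < i)%N -> (U *m Z) i j = 0.
Proof.
elim: d Z => [|d IH] Z; first by exists 1%:M; [exact: unitmx1 | case].
pose Z1 : 'M[int]_(1 + d) := Z.
have [L Lu [P Pu [s _ hs]]] := int_Smith_normal_form (lsubmx Z1).
pose W := invmx L *m Z1.
have hW : dlsubmx W = 0.
  have : lsubmx W = invmx L *m lsubmx Z1 by rewrite /W -mulmx_lsub.
  rewrite hs !mulmxA mulVmx // mul1mx => hl.
  apply/matrixP => i j; rewrite /dlsubmx /= /lsubmx !mxE.
  have := congr1 (fun M : 'M[int]_(1 + d, 1) => M (rshift 1 i) j) hl.
  rewrite /lsubmx !mxE big_ord1 !mxE /= => ->.
  by rewrite mul0r.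
have [U' U'u hU'] := IH (drsubmx W).
exists (block_mx 1%:M 0 0 U' *m invmx L : 'M[int]_(1 + d)).
  rewrite unitmx_mul unitmx_inv Lu andbT.
  by rewrite unitmxE (@det_ublock _ 1 d) det1 mul1r -unitmxE.
move=> i j ji; rewrite -mulmxA.
have -> : invmx L *m Z = block_mx (ulsubmx W) (ursubmx W) 0 (drsubmx W).
  by rewrite -hW submxK.
rewrite (@mulmx_block _ 1 d 1 d 1 d).
rewrite !(mul0mx, mulmx0, mul1mx, addr0, add0r) /block_mx.
case: (split_ordP (i : 'I_(1 + d))) => i' ei; subst i.
  by move: ji; rewrite (ord1 i') ltn0.
rewrite (@col_mxEd _ 1 d (1 + d)).
case: (split_ordP (j : 'I_(1 + d))) => j' ej; subst j.
  by rewrite (@row_mxEl _ d 1 d) mxE.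
by rewrite (@row_mxEr _ d 1 d); apply: hU'.
Qed.

Lemma seq_argmin (R : realDomainType) (T : eqType) (f : T -> R) (s : seq T) x0 :
  x0 \in s -> exists2 x, x \in s & forall y, y \in s -> f x <= f y.
Proof.
elim: s x0 => [//|a s IH] x0 _.
case: s IH => [_|b s IH].
  by exists a; [exact: mem_head | move=> y; rewrite inE => /eqP ->].
have [x xs hx] := IH b (mem_head _ _).
have [fax|fxa] := leP (f a) (f x).
  exists a; first exact: mem_head.
  move=> y; rewrite inE => /orP[/eqP -> //|ys].
  exact: le_trans fax (hx _ ys).
exists x; first by rewrite inE xs orbT.
by move=> y; rewrite inE => /orP[/eqP ->|/hx //]; apply: ltW.
Qed.

Section lattice_points.
Variables (R : realType) (d : nat) (g : 'M[R]_d).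
Hypothesis g_unit : g \in unitmx.

Let e (z : 'cV[int]_d) : 'cV[R]_d := g *m intmx z.

(** Applying the inverse of [g] bounds every entry of [z] by a constant times [r], which leaves
    finitely many integer vectors. *)
Lemma finite_lattice_ball (r : R) :
  finite_set [set z : 'cV[int]_d | `|g *m intmx z| <= r].
Proof.
have [r0|r0] := ltP r 0.
  rewrite (_ : [set _ | _] = set0); first exact: finite_set0.
  rewrite -subset0 => z /=; apply/negP; rewrite -ltNge.
  exact: lt_le_trans r0 (normr_ge0 _).
pose K := Num.bound (\sum_i \sum_j `|invmx g i j| * r).
have hK (z : 'cV[int]_d) i : `|g *m intmx z| <= r -> `|z i 0| <= K%:Z.
  move=> zr.
  have zE : intmx z = invmx g *m (g *m intmx z) :> 'cV[R]_d.
    by rewrite mulmxA mulVmx // mul1mx.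
  have : `|(intmx z : 'cV[R]_d) i 0| <= K%:R.
    rewrite zE mxE; apply: le_trans (ler_norm_sum _ _ _) _.
    apply: le_trans (ltW (archi_boundP _)); last first.
      by apply: sumr_ge0 => ? _; apply: sumr_ge0 => ? _; apply: mulr_ge0.
    rewrite [leRHS](bigD1 i) //= -[leLHS]addr0; apply: lerD.
      apply: ler_sum => j _; rewrite normrM ler_wpM2l //.
      exact: le_trans (cv_norm_ge _ _) zr.
    by apply: sumr_ge0 => ? _; apply: sumr_ge0 => ? _; apply: mulr_ge0.
  by rewrite mxE -intr_norm -[K%:R]/(K%:Z%:~R) ler_int.
pose f (h : {ffun 'I_d -> 'I_(K + K).+1}) : 'cV[int]_d :=
  \col_i ((h i : nat)%:Z - K%:Z).
apply: (@sub_finite_set _ _ (f @` setT)); last first.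
  exact/finite_image/finite_finset.
move=> z /= zr; exists [ffun i => inord `|(z i 0 + K%:Z)%R|%N] => //.
apply/matrixP => i j; rewrite (ord1 j) mxE ffunE inordK.
  have := hK z i zr; rewrite ler_norml => /andP[h _].
  by rewrite gez0_abs ?addrK // -lerBlDr sub0r.
have := hK z i zr; rewrite ler_norml => /andP[h h'].
rewrite ltnS -lez_nat gez0_abs; last by rewrite -lerBlDr sub0r.
by rewrite PoszD lerD2r.
Qed.

Lemma lattice_argmin (P : set 'cV[int]_d) : P !=set0 ->
  exists2 z, P z & forall z', P z' -> `|g *m intmx z| <= `|g *m intmx z'|.
Proof.
move=> [z0 Pz0].
pose B := [set z | `|g *m intmx z| <= `|g *m intmx z0|] `&` P.
have fB : finite_set B by apply: finite_setIl; exact: finite_lattice_ball.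
have z0B : z0 \in fset_set B by rewrite in_fset_set // inE; split => //=.
have [z] := seq_argmin (fun z => `|g *m intmx z|) z0B.
rewrite in_fset_set // inE => -[/= _ Pz] hz; exists z => // z' Pz'.
have [lez'|] := leP `|g *m intmx z'| `|g *m intmx z0|.
  by apply: hz; rewrite in_fset_set // inE; split.
move=> /ltW; apply: le_trans.
by apply: hz.
Qed.

(** The images under [g] of the standard basis vectors span the whole space, so a proper subspace
    misses one of them. *)
Lemma lattice_not_in_proper (V : {vspace 'cV[R]_d}) :
  (\dim V < d)%N -> exists z : 'cV[int]_d, g *m intmx z \notin V.
Proof.
move=> dV; apply/not_existsP => h.
have hV z : e z \in V by apply: contrapT => /negP; exact: h.
have : (fullv <= V)%VS.
  apply/subvP => x _.
  have -> : x = \sum_i (invmx g *m x) i 0 *: e (delta_mx i 0).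
    rewrite -{1}[x](mulKVmx g_unit) {1}[invmx g *m x]matrix_sum_delta.
    rewrite mulmx_sumr; apply: eq_bigr => i _.
    rewrite big_ord1 -scalemxAr /e; congr (_ *: (g *m _)).
    by apply/matrixP => a b; rewrite !mxE; case: (_ && _).
  by apply: memv_suml => i _; apply: memvZ.
move/dimvS; rewrite dimvf /dim /= muln1.
by rewrite leqNgt dV.
Qed.

End lattice_points.

Section minima.
Variables (R : realType) (d : nat) (g : 'M[R]_d).
Hypothesis g_unit : g \in unitmx.

(** A greedy choice of independent lattice vectors, whose norms turn out to be the successive
    minima. Such a family need not generate the lattice, which is why the upper count below passes
    through a unimodular triangularization. *)
Definition minimal_family (s : seq 'cV[int]_d) := forall i, (i < size s)%N ->
  (g *m intmx s`_i \notin <<[seq g *m intmx z | z <- take i s]>>%VS) /\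
  (forall z, g *m intmx z \notin <<[seq g *m intmx z | z <- take i s]>>%VS ->
    `|g *m intmx s`_i| <= `|g *m intmx z|).

Lemma minimal_family_exists k : (k <= d)%N ->
  exists2 s, size s = k & minimal_family s.
Proof.
elim: k => [_|k IH kd]; first by exists [::].
have [s sk hs] := IH (ltnW kd).
have [z0 hz0] : exists z : 'cV[int]_d,
    g *m intmx z \notin <<[seq g *m intmx z | z <- s]>>%VS.
  apply: lattice_not_in_proper => //.
  by apply: leq_ltn_trans (dim_span _) _; rewrite size_map sk.
have [z /= hz hmin] := @lattice_argmin R d g g_unit
  [set z | g *m intmx z \notin <<[seq g *m intmx z | z <- s]>>%VS]
  (ex_intro _ z0 hz0).
exists (rcons s z); first by rewrite size_rcons sk.
move=> i; rewrite size_rcons ltnS leq_eqVlt => /orP[/eqP ->|ik].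
  rewrite nth_rcons ltnn eqxx -cats1 take_size_cat //.
rewrite nth_rcons ik -cats1 takel_cat 1?ltnW //; exact: hs.
Qed.

Section family.
Variable s : seq 'cV[int]_d.
Hypotheses (size_s : size s = d) (min_s : minimal_family s).

Lemma minimal_family_free i : (i <= d)%N ->
  free [seq g *m intmx z | z <- take i s].
Proof.
elim: i => [_|i IH id]; first by rewrite take0 nil_free.
have is' : (i < size s)%N by rewrite size_s.
rewrite (take_nth 0) // map_rcons (perm_free (permEl (perm_rcons _ _))).
rewrite free_cons IH 1?ltnW // andbT.
exact: (min_s is').1.
Qed.

Lemma minimal_family_mono i j : (i <= j < d)%N ->
  `|g *m intmx s`_i| <= `|g *m intmx s`_j|.
Proof.
move=> /andP[ij jd]; have js : (j < size s)%N by rewrite size_s.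
apply: (min_s (leq_ltn_trans ij js)).2.
apply: contraNN (min_s js).1; apply/subvP; apply: sub_span => x.
move=> /mapP[z hz ->]; apply: map_f.
by rewrite -(subnKC ij) takeD mem_cat hz.
Qed.

Lemma minimal_family_gt0 i : (i < d)%N -> 0 < `|g *m intmx s`_i|.
Proof.
move=> id; rewrite normr_gt0; have is' : (i < size s)%N by rewrite size_s.
by apply: contraNneq (min_s is').1 => ->; exact: mem0v.
Qed.

(** Among any i+1 independent lattice vectors one lies outside the span of the first i members of
    [s], hence is at least as long as the next member. The first i+1 members attain this bound
    because their norms increase. *)
Lemma successive_minE i : (i < d)%N ->
  successive_min [set g *m intmx z | z in [set: 'cV[int]_d]] i.+1 =
  `|g *m intmx s`_i|.
Proof.
move=> id; have is' : (i < size s)%N by rewrite size_s.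
rewrite /successive_min; set S := [set l : R | _].
have lb l : S l -> `|g *m intmx s`_i| <= l.
  move=> -[l0 [v [fv hv]]].
  have [x xv xV] : exists2 x, x \in v &
      x \notin <<[seq g *m intmx z | z <- take i s]>>%VS.
    apply: contrapT => h.
    have : (<<v>> <= <<[seq g *m intmx z | z <- take i s]>>)%VS.
      apply/span_subvP => x xv; apply: contrapT => /negP hx; apply: h.
      by exists x.
    move/dimvS; rewrite (eqP fv) (eqP (minimal_family_free (ltnW id))).
    by rewrite size_tuple size_map size_take_min (minn_idPl (ltnW is')) ltnn.
  have [[z _ zx] xl] := hv x xv.
  by apply: le_trans _ xl; rewrite -zx; apply: (min_s is').2; rewrite zx.
have Ss : S `|g *m intmx s`_i|.
  split; first exact: minimal_family_gt0.
  have sz : size [seq g *m intmx z | z <- take i.+1 s] == i.+1.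
    by rewrite size_map size_take_min (minn_idPl is').
  exists (Tuple sz); split; first exact: minimal_family_free.
  move=> x /= /mapP[z zs ->]; split; first by exists z.
  have /(nthP 0)[j] := zs; rewrite size_take_min (minn_idPl is') => ji <-.
  rewrite nth_take //; apply: minimal_family_mono.
  by rewrite -ltnS ji.
apply/eqP; rewrite eq_le; apply/andP; split.
  by apply: ge_inf => //; exists 0 => l [/ltW].
by apply: lb_le_inf => //; exists `|g *m intmx s`_i|.
Qed.

End family.
End minima.

Lemma card_dffun_ord d (K : nat -> nat) :
  #|{: {dffun forall i : 'I_d, 'I_(K i).+1}}| = (\prod_(i < d) (K i).+1)%N.
Proof.
rewrite card_dep_ffun foldrE big_map big_enum.
by apply: eq_bigr => i _; rewrite card_ord.
Qed.

Section counting.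
Variables (R : realType) (d : nat) (g : 'M[R]_d).
Hypothesis g_unit : g \in unitmx.

Definition lattice_ball r : seq 'cV[int]_d :=
  enum_fset (fset_set [set z | `|g *m intmx z| <= r]).

Lemma mem_lattice_ball r z : (z \in lattice_ball r) = (`|g *m intmx z| <= r).
Proof.
rewrite /lattice_ball -[LHS]/(z \in fset_set _) in_fset_set.
  by apply/idP/idP; rewrite inE.
exact: finite_lattice_ball.
Qed.

Lemma uniq_lattice_ball r : uniq (lattice_ball r).
Proof. exact: fset_uniq. Qed.

Variable s : seq 'cV[int]_d.
Hypotheses (size_s : size s = d) (min_s : minimal_family g s).

(** The combinations of the members of [s] with coefficients between 0 and [K i] are pairwise
    distinct by independence, and the triangle inequality keeps them in the ball. *)
Lemma lattice_ball_ge (K : nat -> nat) r :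
  \sum_(i < d) (K i)%:R * `|g *m intmx s`_i| <= r ->
  (\prod_(i < d) (K i).+1 <= size (lattice_ball r))%N.
Proof.
move=> hK; rewrite -card_dffun_ord.
pose phi (f : {dffun forall i : 'I_d, 'I_(K i).+1}) : 'cV[int]_d :=
  \sum_(i < d) s`_i *+ f i.
have ephi f : g *m intmx (phi f) = \sum_(i < d) (f i)%:R *: (g *m intmx s`_i).
  rewrite /phi /intmx raddf_sum mulmx_sumr; apply: eq_bigr => i _.
  rewrite scalemxAr; congr (_ *m _); apply/matrixP => a b.
  by rewrite !mxE mulmxnE raddfMn /= mulr_natl.
have sz : size [seq g *m intmx z | z <- s] == d by rewrite size_map size_s.
have fr : free (Tuple sz).
  by have := minimal_family_free size_s min_s (leqnn d); rewrite take_oversize ?size_s.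
have phi_inj : injective phi.
  move=> f f' ff'; have := ephi f; rewrite ff' ephi => /eqP.
  rewrite -subr_eq0 -sumrB => /eqP h.
  have k0 : forall i : 'I_d, (f i)%:R - (f' i)%:R = 0 :> R.
    apply: (elimT freeP fr (fun i => (f i)%:R - (f' i)%:R)).
    rewrite -[RHS]oppr0 -[in RHS]h -sumrN; apply: eq_bigr => i _ /=.
    by rewrite (nth_map 0) ?size_s // -scalerBl -scaleNr opprB.
  apply/ffunP => i; apply/val_inj/eqP => /=.
  by rewrite -(eqr_nat R) -subr_eq0 k0.
rewrite cardE -(size_map phi).
apply: uniq_leq_size; first by rewrite map_inj_uniq // enum_uniq.
move=> z /mapP[f _ ->]; rewrite mem_lattice_ball ephi.
apply: le_trans (ler_norm_sum _ _ _) _; apply: le_trans _ hK.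
apply: ler_sum => i _; rewrite normrZ ger0_norm // ler_wpM2r // ler_nat.
by rewrite -ltnS.
Qed.

(* With the exponents nonincreasing, all residues of a difference w modulo the
   2 ^ a i vanish only if 2 ^ a i divides w, i the last nonzero triangular
   coordinate of w; the quotient is then too short to have that coordinate
   nonzero. *)
Lemma lattice_ball_le (a : nat -> nat) r :
  {homo a : i j / (i <= j)%N >-> (j <= i)%N} ->
  (forall i, (i < d)%N -> 2 * r < (2 ^ a i)%:R * `|g *m intmx s`_i|) ->
  (size (lattice_ball r) <= \prod_(i < d) 2 ^ a i)%N.
Proof.
move=> a_mono ha.
pose Z : 'M[int]_d := \matrix_(j, i) s`_i j 0.
have [U Uu hU] := unimodular_triangular Z.
have hUs (i j : 'I_d) : (j < i)%N -> (U *m s`_j) i 0 = 0.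
  move=> ji; rewrite -(hU i j ji) !mxE; apply: eq_bigr => k _.
  by rewrite !mxE.
(* Such a [w] is a real combination of the first i members of [s], and each of these has vanishing
   i-th coordinate after multiplication by [U]. *)
have flagU w (i : 'I_d) :
    g *m intmx w \in <<[seq g *m intmx z | z <- take i s]>>%VS ->
    (U *m w) i 0 = 0.
  have is' : (i < size s)%N by rewrite size_s.
  have sz : size [seq g *m intmx z | z <- take i s] == i.
    by rewrite size_map size_take_min (minn_idPl (ltnW is')).
  move=> /(@coord_span _ _ _ (Tuple sz)) hw.
  have wE : intmx w = \sum_(j < i) coord (Tuple sz) j (g *m intmx w) *:
      intmx s`_j :> 'cV[R]_d.
    apply: (can_inj (mulKmx g_unit)); rewrite [LHS]hw mulmx_sumr.
    apply: eq_bigr => j _; rewrite -scalemxAr /= (nth_map 0); last first.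
      by rewrite size_take_min (minn_idPl (ltnW is')).
    by rewrite nth_take.
  have : (intmx (U *m w) : 'cV[R]_d) i 0 = 0.
    rewrite /intmx map_mxM -/(intmx w) wE mulmx_sumr summxE big1 // => j _.
    rewrite -scalemxAr mxE.
    have jd : (j < d)%N by apply: ltn_trans (ltn_ord j) (ltn_ord i).
    have -> : (map_mx intr U *m intmx s`_j : 'cV[R]_d) i 0 =
        ((U *m s`_j) i 0)%:~R by rewrite /intmx -map_mxM mxE.
    by rewrite (hUs i (Ordinal jd) (ltn_ord j)) mulr0z mulr0.
  by rewrite mxE => /eqP; rewrite intr_eq0 => /eqP.
pose q i : int := (2 ^ a i)%:Z.
have q0 i : 0 < q i by rewrite /q ltz_nat expn_gt0.
pose phi (z : 'cV[int]_d) : {dffun forall i : 'I_d, 'I_((2 ^ a i).-1.+1)} :=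
  finfun (fun i : 'I_d => inord `|((U *m z) i ord0 %% q i)%Z|%N).
have phiE z i : (phi z i : nat)%:Z = ((U *m z) i ord0 %% q i)%Z.
  have h0 : 0 <= ((U *m z) i ord0 %% q i)%Z by rewrite modz_ge0 // gt_eqF.
  rewrite ffunE inordK ?gez0_abs //.
  by rewrite prednK ?expn_gt0 // -ltz_nat gez0_abs // ltz_pmod.
have phi_inj : {in lattice_ball r &, injective phi}.
  move=> u v; rewrite !mem_lattice_ball => ur vr uv.
  pose w := u - v.
  have hw i : (q i %| (U *m w) i ord0)%Z.
    have := congr1 (fun f : {dffun forall i : 'I_d, 'I_((2 ^ a i).-1.+1)} =>
       (f i : nat)%:Z) uv.
    rewrite /= !phiE => /eqP; rewrite eqz_mod_dvd /w mulmxBr.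
    by move: (U *m u) (U *m v) => u' v'; rewrite !mxE.
  apply/eqP; rewrite -subr_eq0 -/w; apply/negPn/negP => w0.
  have Uw0 : U *m w != 0.
    by apply: contra_neq w0 => Uw0; rewrite -(mulKmx Uu w) Uw0 mulmx0.
  have [i1 hi1] : exists i, (U *m w) i 0 != 0.
    apply/existsP; apply: contra_neqT Uw0 => /existsPn h.
    by apply/matrixP => i j; rewrite (ord1 j) [RHS]mxE; apply/eqP/negPn/h.
  case: (@arg_maxnP _ i1 (fun i => (U *m w) i 0 != 0) (fun i => i) hi1).
  move=> i hi imax.
  (* Up to [i] this uses that the exponents do not increase; beyond [i] the coordinates vanish by
     maximality. *)
  have div j : (q i %| (U *m w) j ord0)%Z.
    have [ji|ij] := leqP j i.
      apply: dvdz_trans (hw j); rewrite /q dvdzE /=.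
      by rewrite dvdn_exp2l // a_mono.
    have [-> |nz] := eqVneq ((U *m w) j 0) 0; first exact: dvdz0.
    have ji : (j <= i)%N := imax j nz.
    by move: ij; rewrite ltnNge ji.
  pose y : 'cV[int]_d := \col_j ((U *m w) j ord0 %/ q i)%Z.
  have yE : U *m w = q i *: y.
    apply/matrixP => j k; rewrite (ord1 k) [RHS]mxE [X in _ = _ * X]mxE mulrC.
    by rewrite divzK.
  pose z := invmx U *m y.
  have zE : w = q i *: z.
    by rewrite /z scalemxAr -yE mulKmx.
  have ewz : g *m intmx w = (2 ^ a i)%:R *: (g *m intmx z).
    rewrite zE [RHS]scalemxAr; congr (_ *m _).
    by apply/matrixP => j k; rewrite !mxE intrM.
  have id : (i < d)%N by [].
  have is' : (i < size s)%N by rewrite size_s.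
  have : `|g *m intmx z| < `|g *m intmx s`_i|.
    rewrite -(@ltr_pM2l _ (2 ^ a i)%:R) ?ltr0n ?expn_gt0 //.
    apply: le_lt_trans (ha i id).
    have -> : (2 ^ a i)%:R * `|g *m intmx z| = `|g *m intmx w|.
      by rewrite ewz normrZ ger0_norm.
    rewrite /w intmxD intmxN mulmxBr.
    by apply: le_trans (ler_normB _ _) _; lra.
  move=> hlt; move: hi; rewrite -[X in X != _](_ : (q i *: (U *m z)) i 0 = _).
    rewrite mxE (_ : (U *m z) i 0 = 0) ?mulr0 ?eqxx //.
    apply: flagU; apply: contrapT => /negP /(min_s is').2.
    by rewrite leNgt hlt.
  by rewrite zE -scalemxAr.
have : uniq (map phi (lattice_ball r)).
  by rewrite map_inj_in_uniq ?uniq_lattice_ball.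
move/card_uniqP => h; rewrite -(size_map phi) -h.
apply: leq_trans (max_card _) _; rewrite (card_dffun_ord d (fun i => (2 ^ a i).-1)).
by apply: leq_prod => i _; rewrite prednK // expn_gt0.
Qed.

End counting.

(** The least power of 2 above [x]. Minimality is kept in the statement because it makes the
    exponents monotone in [x]. *)
Lemma pow2_bracket (R : realType) (x : R) : 0 < x ->
  exists a : nat, [/\ x < (2 ^ a)%:R, (2 ^ a)%:R <= 2 * Num.max x 1 &
    forall b : nat, x < (2 ^ b)%:R -> (a <= b)%N].
Proof.
move=> x0.
have ex : exists a : nat, x < (2 ^ a)%:R.
  exists (Num.bound x); apply: lt_trans (archi_boundP (ltW x0)) _.
  by rewrite ltr_nat ltn_expl.
case: (ex_minnP ex) => -[|a] ha amin; [exists 0%N | exists a.+1]; split => //.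
  have : 1 <= Num.max x 1 by rewrite le_max lexx orbT.
  by rewrite expn0; lra.
rewrite expnS natrM ler_pM2l // le_max; apply/orP; left.
by rewrite leNgt; apply/negP => /amin; rewrite ltnn.
Qed.

Section count_vs_minima.
Variables (R : realType) (d : nat) (g : 'M[R]_d).
Hypothesis g_unit : g \in unitmx.

Definition minima_prod (r : R) : R := \prod_(i < d)
  Num.max (r / successive_min [set g *m intmx z | z in [set: 'cV[int]_d]] i.+1) 1.

Lemma minima_prod_le r : 0 < r ->
  minima_prod r <= d%:R ^+ d * (size (lattice_ball g r))%:R.
Proof.
move=> r0; have [s ss ms] := minimal_family_exists g_unit (leqnn d).
(* Each of the [d] terms then has norm at most r / d, while d * (K i + 1) exceeds both r / lambda_i
   and 1. *)
pose K i := Num.trunc (r / (d%:R * `|g *m intmx s`_i|)).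
have lam0 i : (i < d)%N -> 0 < `|g *m intmx s`_i| by apply: minimal_family_gt0.
have d0 i : (i < d)%N -> 0 < d%:R :> R by move=> id; rewrite ltr0n (leq_trans _ id).
have : (\prod_(i < d) (K i).+1 <= size (lattice_ball g r))%N.
  apply: (lattice_ball_ge g_unit ss ms).
  have [dz|dpos] := posnP d.
    by rewrite big1 ?ltW // => -[i ilt] _; exfalso; rewrite dz in ilt.
  apply: (@le_trans _ _ (\sum_(i < d) r / d%:R)); last first.
    by rewrite sumr_const card_ord -[_ *+ _]mulr_natr divfK // pnatr_eq0 -lt0n.
  apply: ler_sum => i _; rewrite -ler_pdivlMr ?lam0 //.
  apply: le_trans (_ : r / (d%:R * `|g *m intmx s`_i|) <= _).
    by rewrite truncn_le divr_ge0 ?mulr_ge0 // ltW.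
  by rewrite invfM mulrA.
rewrite -(ler_nat R) natr_prod => h.
apply: le_trans (ler_wpM2l _ h); last by rewrite exprn_ge0.
rewrite -[X in d%:R ^+ X](card_ord d) -prodr_const -big_split /=.
apply: ler_prod => i _; rewrite (successive_minE ss ms) //.
rewrite le_max ler01 orbT /= ge_max; apply/andP; split.
  rewrite -ler_pdivrMl ?(d0 i) // mulrCA -invfM.
  exact/ltW/truncnS_gt.
by rewrite -natrM ler1n muln_gt0 (leq_ltn_trans _ (ltn_ord i)).
Qed.

Lemma minima_prod_ge r : 0 < r ->
  (size (lattice_ball g r))%:R <= 4 ^+ d * minima_prod r.
Proof.
move=> r0; have [s ss ms] := minimal_family_exists g_unit (leqnn d).
have lam0 i : (i < d)%N -> 0 < `|g *m intmx s`_i| by apply: minimal_family_gt0.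
(* The chosen power is at most 2 * max (2r / lambda_i, 1), hence at most 4 * max (r / lambda_i, 1):
   this is the origin of the factor 4 ^ d. *)
have exa i : exists a : nat, (i < d)%N ->
   [/\ 2 * r / `|g *m intmx s`_i| < (2 ^ a)%:R,
     (2 ^ a)%:R <= 2 * Num.max (2 * r / `|g *m intmx s`_i|) 1 &
    forall b : nat, 2 * r / `|g *m intmx s`_i| < (2 ^ b)%:R -> (a <= b)%N].
  have [id|] := ltnP i d; last by exists 0%N.
  have [|a ha] := @pow2_bracket R (2 * r / `|g *m intmx s`_i|).
    by rewrite divr_gt0 ?mulr_gt0 ?lam0.
  by exists a.
have [a0 ha0] := choice exa.
(* The value 0 beyond [d] makes the exponents nonincreasing on all of [nat]. *)
pose a i := if (i < d)%N then a0 i else 0%N.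
have : (size (lattice_ball g r) <= \prod_(i < d) 2 ^ a i)%N.
  apply: (lattice_ball_le g_unit ss ms) => [i j ij|i id].
    rewrite /a; case: ltnP => // jd; rewrite (leq_ltn_trans ij jd).
    have [_ _ hmin] := ha0 j jd.
    have [hi _ _] := ha0 i (leq_ltn_trans ij jd).
    apply: hmin; apply: le_lt_trans hi.
    rewrite ler_pM2l ?mulr_gt0 // lef_pV2 ?posrE ?lam0 ?(leq_ltn_trans ij jd) //.
    by apply: (minimal_family_mono ss ms); rewrite ij.
  by rewrite /a id -ltr_pdivrMr ?lam0 //; case: (ha0 i id).
rewrite -(ler_nat R) natr_prod => /le_trans; apply.
rewrite -[in 4 ^+ d](card_ord d) -prodr_const -big_split /=.
apply: ler_prod => i _; rewrite (successive_minE ss ms) // ler0n /=.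
have id := ltn_ord i; have [_ h _] := ha0 i id; rewrite /a id.
apply: le_trans h _; set l := `|_|.
have x0 : 0 <= r / l by rewrite divr_ge0 ?normr_ge0 ?(ltW r0).
have -> : 2 * r / l = 2 * (r / l) by rewrite mulrA.
set M := Num.max (r / l) 1.
have h1 : r / l <= M by rewrite le_max lexx.
have h2 : 1 <= M by rewrite le_max lexx orbT.
suff : Num.max (2 * (r / l)) 1 <= 2 * M by lra.
by rewrite ge_max; apply/andP; split; lra.
Qed.

End count_vs_minima.

(** * Boxes of integer points and the product of minima *)

Section boxes.
Variables (R : realType) (m n : nat) (A : 'M[R]_(m, n)).
Hypotheses (m_gt0 : (0 < m)%N) (n_gt0 : (0 < n)%N).
Local Notation d := (m + n)%N.
Implicit Types (z : 'cV[int]_d) (r Q a : R).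

(* Elements of Z^(m+n) are z = (p, q), and [top z] is A q + p: the integer
   vector p of the definition of [D] appears here with the opposite sign. *)
Definition top z : 'cV[R]_m := intmx (usubmx z) + A *m intmx (dsubmx z).
Definition bot z : 'cV[R]_n := intmx (dsubmx z).

Lemma top0 : top 0 = 0.
Proof. by rewrite /top !raddf0 !intmx0 mulmx0 addr0. Qed.

Lemma bot0 : bot 0 = 0.
Proof. by rewrite /bot raddf0 intmx0. Qed.

Lemma topD z z' : top (z + z') = top z + top z'.
Proof. by rewrite /top !raddfD /= !intmxD mulmxDr addrACA. Qed.

Lemma botD z z' : bot (z + z') = bot z + bot z'.
Proof. by rewrite /bot raddfD /= intmxD. Qed.

Lemma topN z : top (- z) = - top z.
Proof. by rewrite /top !raddfN /= !intmxN mulmxN opprD. Qed.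

Lemma botN z : bot (- z) = - bot z.
Proof. by rewrite /bot raddfN /= intmxN. Qed.

Definition shift_top (p : 'cV[int]_m) : 'cV[int]_d := col_mx p 0.

Lemma top_shift p : top (shift_top p) = intmx p.
Proof. by rewrite /top col_mxKu col_mxKd intmx0 mulmx0 addr0. Qed.

Lemma bot_shift p : bot (shift_top p) = 0.
Proof. by rewrite /bot col_mxKd intmx0. Qed.

Lemma lattice_vector t z : amx t *m umx A *m intmx z =
  col_mx (expR (t / m%:R) *: top z) (expR (- t / n%:R) *: bot z) :> 'cV[R]_d.
Proof.
rewrite -[X in intmx X]vsubmxK /intmx map_col_mx -mulmxA /umx /amx.
rewrite !mul_block_col !mul1mx !mul0mx add0r !mul_scalar_mx !addr0 !add0r.
by [].
Qed.

Lemma cv_norm_col r (x : 'cV[R]_m) (y : 'cV[R]_n) : 0 <= r ->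
  (`|col_mx x y| <= r) = (`|x| <= r) && (`|y| <= r).
Proof.
move=> r0; apply/idP/andP.
  move/(cv_norm_leP _ r0) => h; split; apply/cv_norm_leP => // i.
    by have := h (lshift n i); rewrite col_mxEu.
  by have := h (rshift m i); rewrite col_mxEd.
move=> [/(cv_norm_leP _ r0) hx /(cv_norm_leP _ r0) hy].
apply/cv_norm_leP => // i; case: (split_ordP i) => j ->.
  by rewrite col_mxEu.
by rewrite col_mxEd.
Qed.

(* [box r Q] is the set of z with |top z| <= r and |bot z| <= Q (see [mem_box]),
   obtained as a ball of the lattice a_t u_A Z^d whose minima define [Nprod]. *)
Definition box_radius r Q := Q `^ (n%:R / d%:R) * r `^ (m%:R / d%:R).
Definition box_matrix r Q : 'M[R]_d := amx (@flow_time R m n r Q) *m umx A.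
Definition box r Q := lattice_ball (box_matrix r Q) (box_radius r Q).

Lemma box_matrix_unit r Q : box_matrix r Q \in unitmx.
Proof.
rewrite /box_matrix unitmx_mul; apply/andP; split.
  rewrite unitmxE /amx det_ublock !det_scalar unitfE mulf_neq0 //.
    by rewrite expf_neq0 // gt_eqF ?expR_gt0.
  by rewrite expf_neq0 // gt_eqF ?expR_gt0.
by rewrite unitmxE /umx det_ublock !det1 mulr1 unitr1.
Qed.

(** The flow time balances the two blocks: with t = [flow_time r Q], both e^(t/m) r and e^(-t/n) Q
    equal [box_radius r Q]. *)
Lemma mem_box r Q z : 0 < r -> 0 < Q ->
  (z \in box r Q) = (`|top z| <= r) && (`|bot z| <= Q).
Proof.
move=> r0 Q0; rewrite mem_lattice_ball ?box_matrix_unit // lattice_vector.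
have d0 : m%:R + n%:R != 0 :> R by rewrite -natrD pnatr_eq0 -lt0n addn_gt0 m_gt0.
have mR : m%:R != 0 :> R by rewrite pnatr_eq0 -lt0n.
have nR : n%:R != 0 :> R by rewrite pnatr_eq0 -lt0n.
rewrite cv_norm_col ?mulr_ge0 ?powR_ge0 // !normrZ !(gtr0_norm (expR_gt0 _)).
rewrite ![_ * `|_|]mulrC -!ler_pdivlMr ?expR_gt0 // -!expRN.
rewrite /box_radius /powR !gt_eqF // -!expRD /flow_time natrM natrD ln_div ?posrE //.
set u := (X in _ <= expR X); set v := (X in _ && (_ <= expR X)).
have -> : u = ln r by rewrite /u; field; rewrite mR d0.
have -> : v = ln Q by rewrite /v; field; rewrite nR d0.
by rewrite !lnK ?posrE.
Qed.

Lemma uniq_box r Q : uniq (box r Q).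
Proof. exact: uniq_lattice_ball. Qed.

Lemma Nprod_ge1 r Q : 1 <= Nprod A r Q.
Proof.
apply: (big_ind (fun x => 1 <= x)) => // [x y x1 y1|i _].
  by rewrite -[1]mulr1 ler_pM.
by rewrite le_max lexx orbT.
Qed.

Lemma Nprod_gt0 r Q : 0 < Nprod A r Q.
Proof. exact: lt_le_trans (Nprod_ge1 r Q). Qed.

Lemma box_radius_gt0 r Q : 0 < r -> 0 < Q -> 0 < box_radius r Q.
Proof. by move=> *; rewrite mulr_gt0 // powR_gt0. Qed.

Lemma Nprod_le_box r Q : 0 < r -> 0 < Q ->
  Nprod A r Q <= d%:R ^+ d * (size (box r Q))%:R.
Proof.
move=> r0 Q0.
exact: (minima_prod_le (box_matrix_unit r Q) (box_radius_gt0 r0 Q0)).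
Qed.

Lemma box_le_Nprod r Q : 0 < r -> 0 < Q ->
  (size (box r Q))%:R <= 4 ^+ d * Nprod A r Q.
Proof.
move=> r0 Q0.
exact: (minima_prod_ge (box_matrix_unit r Q) (box_radius_gt0 r0 Q0)).
Qed.

(** The flow time depends only on Q / r, so the lattice is unchanged; the radius is multiplied by
    [a], and each factor grows at most by [a]. *)
Lemma Nprod_scale a r Q : 1 <= a -> 0 < r -> 0 < Q ->
  Nprod A (a * r) (a * Q) <= a ^+ d * Nprod A r Q.
Proof.
move=> a1 r0 Q0; have a0 : 0 < a by apply: lt_le_trans a1.
rewrite /Nprod -[X in a ^+ X](card_ord d) -prodr_const -big_split /=.
have -> : @flow_time R m n (a * r) (a * Q) = @flow_time R m n r Q.
  by rewrite /flow_time -mulf_div divff ?mul1r // gt_eqF.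
have d0 : m%:R + n%:R != 0 :> R by rewrite -natrD pnatr_eq0 -lt0n addn_gt0 m_gt0.
have -> : (a * Q) `^ (n%:R / d%:R) * (a * r) `^ (m%:R / d%:R) =
    a * (Q `^ (n%:R / d%:R) * r `^ (m%:R / d%:R)).
  rewrite /powR !gt_eqF ?mulr_gt0 // -!expRD !lnM ?posrE //.
  rewrite -[X in _ = X * _]lnK ?posrE // -expRD; congr expR.
  by rewrite natrD; field.
apply: ler_prod => i _; rewrite le_max ler01 orbT /=.
rewrite maxr_pMr ?(ltW a0) // mulr1 ge_max !le_max !mulrA lexx /=.
by rewrite a1 orbT.
Qed.

End boxes.

(** * Hausdorff dimension *)

Section hausdorff.
Variables (R : realType) (T : metricType R).
Implicit Types (E F : set T) (s delta eps : R).

Lemma diam_ge0 E : E !=set0 -> (0 <= diam E)%E.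
Proof.
move=> [x Ex]; apply: ereal_sup_ubound; exists (x, x) => //=.
by rewrite mdistxx.
Qed.

Lemma diam_pow_ge0 s E : (0 <= diam_pow s E)%E.
Proof. by rewrite /diam_pow; case: ifP => // _; exact: poweR_ge0. Qed.

Lemma diam_pow0 s : diam_pow s (set0 : set T) = 0%E.
Proof. by rewrite /diam_pow eqxx. Qed.

Lemma diam_le E delta : (forall x y, E x -> E y -> mdist x y <= delta) ->
  (diam E <= delta%:E)%E.
Proof.
by move=> h; apply: ge_ereal_sup => _ [[x y] [/= Ex Ey] <-]; rewrite lee_fin h.
Qed.

Lemma mdist_le_diam E x y : E x -> E y -> ((mdist x y)%:E <= diam E)%E.
Proof. by move=> Ex Ey; apply: ereal_sup_ubound; exists (x, y). Qed.

Lemma diam_finP E delta : E !=set0 -> (diam E <= delta%:E)%E ->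
  exists2 r : R, diam E = r%:E & 0 <= r <= delta.
Proof.
move=> /diam_ge0; case: (diam E) => [r| |] //.
by rewrite !lee_fin => r0 rd; exists r; rewrite ?r0.
Qed.

Lemma diam_pow_le E s delta : 0 <= s -> 0 <= delta -> (diam E <= delta%:E)%E ->
  (diam_pow s E <= (delta `^ s)%:E)%E.
Proof.
move=> s0 d0 Ed; rewrite /diam_pow; case: ifPn => [_|/set0P E0].
  by rewrite lee_fin powR_ge0.
have [r -> /andP[r0 rd]] := diam_finP E0 Ed.
by rewrite poweR_EFin lee_fin ge0_ler_powR.
Qed.

Lemma diam_pow_le_exp E s s' : 0 <= s <= s' -> (diam E <= 1%:E)%E ->
  (diam_pow s' E <= diam_pow s E)%E.
Proof.
move=> /andP[s0 ss'] Ed; rewrite /diam_pow; case: ifPn => // /set0P E0.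
have [r -> /andP[r0 r1]] := diam_finP E0 Ed.
rewrite !poweR_EFin lee_fin.
(* For diameter zero the weight is 1 at exponent 0 and 0 at positive exponents, which is still
   nonincreasing. *)
move: r0; rewrite le_eqVlt => /orP[/eqP <-|r0].
  move: s0; rewrite le_eqVlt => /orP[/eqP <-|s0].
    rewrite powRr0; have [->|s'0] := eqVneq s' 0; first by rewrite powRr0.
    by rewrite powR0 // ler01.
  by rewrite !powR0 // gt_eqF // (lt_le_trans s0).
by apply: ger_powR => //; rewrite r0.
Qed.

Definition hausdorff_null s E := forall delta eps, 0 < delta -> 0 < eps ->
  exists U : nat -> set T, [/\ E `<=` \bigcup_i U i,
    forall i, (diam (U i) <= delta%:E)%E &
    (\sum_(0 <= i <oo) diam_pow s (U i) <= eps%:E)%E].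

Lemma hausdorff_nullP s E : hausdorff_measure s E = 0%E <-> hausdorff_null s E.
Proof.
have series_ge0 (U : nat -> set T) :
    (0 <= \sum_(0 <= i <oo) diam_pow s (U i))%E.
  by apply: nneseries_ge0 => i _ _; exact: diam_pow_ge0.
have pre_ge0 delta : (0 <= hausdorff_premeasure s delta E)%E.
  by apply: le_ereal_inf_tmp => _ [U _ <-]; exact: series_ge0.
split => [h delta eps d0 e0|h].
  have : (hausdorff_premeasure s delta E <= 0)%E.
    by rewrite -h; apply: ereal_sup_ubound; exists delta.
  move=> /le_lt_trans => /(_ eps%:E); rewrite lte_fin => /(_ e0).
  move/ereal_inf_lt => [_ [U [EU Ud] <-] /ltW Ue].
  by exists U.
apply/eqP; rewrite eq_le; apply/andP; split.
  apply: ge_ereal_sup => _ [delta d0 <-].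
  apply/lee_addgt0Pr => eps e0; rewrite add0e.
  have [U [EU Ud Ue]] := h delta eps d0 e0.
  by apply: le_trans Ue; apply: ereal_inf_lbound; exists U.
apply: le_trans (pre_ge0 1) _.
by apply: ereal_sup_ubound; exists 1 => //=.
Qed.

Lemma hausdorff_null_subset s E F : E `<=` F ->
  hausdorff_null s F -> hausdorff_null s E.
Proof.
move=> EF h delta eps d0 e0; have [U [FU Ud Ue]] := h delta eps d0 e0.
by exists U; split => //; exact: subset_trans FU.
Qed.

Lemma hausdorff_null_le s s' E : 0 <= s <= s' ->
  hausdorff_null s E -> hausdorff_null s' E.
Proof.
move=> ss' h delta eps d0 e0.
have m0 : 0 < Num.min delta 1 by rewrite lt_min d0 ltr01.
have [U [EU Ud Ue]] := h _ _ m0 e0; exists U; split => //.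
  by move=> i; apply: le_trans (Ud i) _; rewrite lee_fin ge_min lexx.
apply: le_trans Ue; apply: lee_nneseries => [i *|i _].
  exact: diam_pow_ge0.
apply: diam_pow_le_exp => //.
by apply: le_trans (Ud i) _; rewrite lee_fin ge_min lexx orbT.
Qed.

(** The i-th set is covered with total weight eps / 2^(i+1), and a bijection of [nat] with
    [nat * nat] merges the covers into one sequence. *)
Lemma hausdorff_null_bigcup s (E : nat -> set T) :
  (forall i, hausdorff_null s (E i)) -> hausdorff_null s (\bigcup_i E i).
Proof.
move=> h delta eps d0 e0.
have ei i : 0 < eps / (2 ^ i.+1)%:R by rewrite divr_gt0 // ltr0n expn_gt0.
have [V hV] := choice (fun i => h i delta _ d0 (ei i)).
have /card_esym/ppcard_eqP[f] := card_nat2.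
exists (fun k => V (f k).1 (f k).2); split.
- move=> x [i _ Eix]; have [VE _ _] := hV i; have [j _ Vx] := VE x Eix.
  by exists (f^-1%FUN (i, j)) => //; rewrite invK ?inE.
- by move=> k; have [_ + _] := hV (f k).1; apply.
have nn i j : (0 <= diam_pow s (V i j))%E by exact: diam_pow_ge0.
pose a (p : nat * nat) := diam_pow s (V p.1 p.2).
rewrite nneseries_esumT //.
have fbij : set_bij [set: nat] [set: nat * nat] f by apply: bij.
rewrite -(reindex_esum _ _ _ a fbij).
have -> : [set: nat * nat] = [set: nat] `*`` (fun=> [set: nat]).
  by apply/seteqP; split => -[i j].
rewrite -(@esum_esum _ _ _ setT (fun=> setT) (fun i j => a (i, j))) //.
apply: le_trans (epsilon_trick0 xpredT (ltW e0)).
rewrite -nneseries_esumT; last by move=> i; by apply: esum_ge0 => *; exact: nn.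
apply: lee_nneseries => [i *|i _].
  by apply: esum_ge0 => *; exact: nn.
rewrite -nneseries_esumT; last by move=> j; exact: nn.
  by case: (hV i).
by move=> *; exact: nn.
Qed.

Lemma hausdorff_dim_ge0 E : (0 <= hausdorff_dim E)%E.
Proof. by apply: le_ereal_inf_tmp => _ [s [s0 _] <-]; rewrite lee_fin. Qed.

Lemma hausdorff_dim_le s E : 0 <= s -> hausdorff_null s E ->
  (hausdorff_dim E <= s%:E)%E.
Proof.
by move=> s0 h; apply: ereal_inf_lbound; exists s => //; split => //;
  apply/hausdorff_nullP.
Qed.

Lemma hausdorff_dim_lt s E : (hausdorff_dim E < s%:E)%E -> hausdorff_null s E.
Proof.
move/ereal_inf_lt => [_ [s' [s'0 /hausdorff_nullP h] <-]].
by rewrite lte_fin => /ltW s's; apply: hausdorff_null_le h; rewrite s'0.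
Qed.

Lemma hausdorff_dim_subset E F : E `<=` F ->
  (hausdorff_dim E <= hausdorff_dim F)%E.
Proof.
move=> EF; apply: le_ereal_inf_tmp => _ [s [s0 /hausdorff_nullP h] <-].
by apply: hausdorff_dim_le => //; exact: hausdorff_null_subset h.
Qed.

Lemma hausdorff_dim_le_lt (x : \bar R) E : (0 <= x)%E ->
  (forall s, (x < s%:E)%E -> hausdorff_null s E) -> (hausdorff_dim E <= x)%E.
Proof.
case: x => [x| |] //; last by move=> *; exact: leey.
rewrite lee_fin => x0 h; apply/lee_addgt0Pr => eps e0; rewrite -EFinD.
apply: hausdorff_dim_le; first by rewrite addr_ge0 // ltW.
by apply: h; rewrite lte_fin ltrDl.
Qed.

Lemma hausdorff_dim_bigcup (x : \bar R) (E : nat -> set T) :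
  (forall i, (hausdorff_dim (E i) <= x)%E) ->
  (hausdorff_dim (\bigcup_i E i) <= x)%E.
Proof.
move=> h; apply: hausdorff_dim_le_lt.
  exact: le_trans (hausdorff_dim_ge0 (E 0%N)) (h 0%N).
move=> s xs; apply: hausdorff_null_bigcup => i; apply: hausdorff_dim_lt.
exact: le_lt_trans (h i) xs.
Qed.

End hausdorff.

(** * Cantor sets from product trees *)

Section product_tree.
Variables (R : realType) (V : eqType) (Z : nat -> seq V) (M : nat -> R).
Hypotheses (M_gt0 : forall k, 0 < M k) (M_size : forall k, M k <= (size (Z k))%:R).
Hypothesis Z_uniq : forall k, uniq (Z k).

(** The weight of a vertex of depth [k]. As [M k] is at most the number of children, the children
    together weigh at least as much as their parent. *)
Definition tree_weight k := \prod_(j < k) (M j)^-1.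

Lemma tree_weight_gt0 k : 0 < tree_weight k.
Proof. by apply: prodr_gt0 => j _; rewrite invr_gt0. Qed.

Lemma tree_weightS k : M k * tree_weight k.+1 = tree_weight k.
Proof. by rewrite /tree_weight big_ord_recr /= mulrC mulfVK // gt_eqF. Qed.

Lemma tree_branch_exists : exists b : nat -> V, forall k, b k \in Z k.
Proof.
suff /choice[b hb] : forall k, exists v, v \in Z k by exists b.
move=> k; have : 0 < (size (Z k))%:R :> R by apply: lt_le_trans (M_size k).
by rewrite ltr0n; case: (Z k) => // v s _; exists v; exact: mem_head.
Qed.

Variables (beta : nat -> nat -> V) (kappa : nat -> nat) (theta : R).
Hypothesis theta01 : 0 <= theta < 1.
Hypothesis sum_weights :
  forall n, \sum_(i < n) tree_weight (kappa i) <= theta.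

Let agree k (b : nat -> V) i := all (fun j => b j == beta i j) (iota 0 k).
(** The i-th excluded vertex is the prefix of [beta i] of length [kappa i]. The load measures the
    excluded vertices below the depth-k vertex of [b]; truncating at [n] keeps all sums finite. *)
Let load n k b :=
  \sum_(i < n | (k <= kappa i)%N && agree k b i) tree_weight (kappa i).
Let upd (b : nat -> V) k v := fun j => if j == k then v else b j.
Let good k b := forall n, load n k b <= theta * tree_weight k.

Let agree_eq k b b' i : (forall j, (j < k)%N -> b j = b' j) ->
  agree k b i = agree k b' i.
Proof.
by move=> h; apply: eq_in_all => j; rewrite mem_iota add0n => /h ->.
Qed.

Let load_mono n n' k b : (n <= n')%N -> load n k b <= load n' k b.
Proof.
move=> nn'; rewrite /load -(subnKC nn') big_split_ord /= lerDl.
by apply: sumr_ge0 => i _; apply/ltW/tree_weight_gt0.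
Qed.

(** An excluded vertex lies below at most one child, since the children are listed without
    repetition. *)
Let sum_load_upd n k b :
  \sum_(v <- Z k) load n k.+1 (upd b k v) <= load n k b.
Proof.
rewrite /load.
under eq_bigr do rewrite big_mkcond.
rewrite exchange_big /= [leRHS]big_mkcond; apply: ler_sum => i _.
have aS v : agree k.+1 (upd b k v) i = agree k b i && (v == beta i k).
  rewrite /agree -addn1 iotaD all_cat add0n /= andbT /upd eqxx.
  congr (_ && _); apply: agree_eq => j jk; rewrite ifN //.
  by rewrite neq_ltn jk.
under eq_bigr do rewrite aS.
have w0 := ltW (tree_weight_gt0 (kappa i)).
case: ifPn => [/andP[kk ab]|h].
  case: (boolP (beta i k \in Z k)) => hb.
    rewrite (bigD1_seq (beta i k)) //= big1 ?addr0; first by case: ifP.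
    by move=> v /negPf ->; rewrite !andbF.
  rewrite big_seq big1 // => v vZ; case: ifP => // /and3P[_ _ /eqP vb].
  by move: hb; rewrite -vb vZ.
rewrite big1 // => v _; case: ifP => // /and3P[kk ab _].
by move: h; rewrite ab (ltnW kk).
Qed.

Let good_step k b : good k b ->
  exists2 v, v \in Z k & good k.+1 (upd b k v).
Proof.
move=> gb; apply: contrapT => h.
have bad v : exists n, v \in Z k ->
    theta * tree_weight k.+1 < load n k.+1 (upd b k v).
  apply: contrapT => /forallNP hv; apply: h; exists v.
    by apply: contrapT => vZ; apply: (hv 0%N).
  move=> n; rewrite leNgt; apply/negP => hn; exact: (hv n).
have [nv hnv] := choice bad.
(* Each child would be overloaded at some index of its own; loads increase with the index, so the
   maximum serves all children at once. *)
pose n := (\max_(v <- Z k) nv v)%N.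
have : \sum_(v <- Z k) theta * tree_weight k.+1 <
    \sum_(v <- Z k) load n k.+1 (upd b k v).
  rewrite big_seq [ltRHS]big_seq; apply: ltr_sum.
    have : 0 < (size (Z k))%:R :> R by apply: lt_le_trans (M_size k).
    by rewrite ltr0n; case: (Z k) => // v s _; rewrite /= mem_head.
  move=> v vZ; apply: lt_le_trans (hnv v vZ) _; apply: load_mono.
  exact: leq_bigmax_seq.
move=> /lt_le_trans /(_ (le_trans (sum_load_upd n k b) (gb n))).
rewrite ltNge => /negP; apply.
rewrite big_const_seq count_predT iter_addr_0 -mulr_natl -tree_weightS.
rewrite mulrCA ler_wpM2r //; last first.
  by rewrite mulr_ge0 ?(ltW (tree_weight_gt0 _)) //; case/andP: theta01.
Qed.

(* Greedy descent: among the children of a vertex below which the excluded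
   weight is less than its own weight, one has the same property. *)
Lemma tree_avoid : exists b : nat -> V, (forall k, b k \in Z k) /\
  forall i, exists2 j, (j < kappa i)%N & b j <> beta i j.
Proof.
have [b0 b0Z] := tree_branch_exists.
have ex (p : nat * (nat -> V)) : exists v, good p.1 p.2 ->
    v \in Z p.1 /\ good p.1.+1 (upd p.2 p.1 v).
  have [/good_step[v vZ gv]|] := pselect (good p.1 p.2); first by exists v.
  by exists (b0 0%N).
have [next hnext] := choice ex.
pose B := nat_rect (fun=> nat -> V) b0 (fun k b => upd b k (next (k, b))).
have gB k : good k (B k).
  elim: k => [n|k IH]; last by have [] := hnext (k, B k) IH.
  rewrite /load [tree_weight 0]/tree_weight big_ord0 mulr1.
  apply: le_trans (sum_weights n); rewrite [leLHS]big_mkcond /=.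
  exact: ler_sum.
pose b k := next (k, B k).
have Bb k j : (j < k)%N -> B k j = b j.
  elim: k => // k IH; rewrite ltnS leq_eqVlt /= /upd => /orP[/eqP ->|jk].
    by rewrite eqxx.
  by rewrite ltn_eqF // IH.
exists b; split=> [k|i]; first by have [] := hnext (k, B k) (gB k).
apply: contrapT => h.
(* If [b] ran through the i-th excluded vertex, the load there would be at least the full weight of
   that vertex, while a good branch allows only the fraction [theta] < 1 of it. *)
have ag : agree (kappa i) (B (kappa i)) i.
  apply/allP => j; rewrite mem_iota add0n => /= jk; rewrite Bb //.
  by apply/eqP; apply: contrapT => ne; apply: h; exists j.
have := gB (kappa i) i.+1; rewrite /load big_mkcond big_ord_recr /= leqnn ag /=.
apply/negP; rewrite -ltNge.
have w0 := tree_weight_gt0 (kappa i).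
apply: (@lt_le_trans _ _ (tree_weight (kappa i))).
  by rewrite gtr_pMl //; case/andP: theta01.
rewrite lerDr; apply: sumr_ge0 => j _; case: ifP => // _.
exact/ltW/tree_weight_gt0.
Qed.

End product_tree.

Lemma sum_geometric_half (R : realType) (x : R) n : 0 <= x ->
  \sum_(i < n) x / (2 ^ i.+1)%:R <= x.
Proof.
move=> x0; suff -> : \sum_(i < n) x / (2 ^ i.+1)%:R = x - x / (2 ^ n)%:R.
  by rewrite gerBl divr_ge0.
elim: n => [|n IH]; first by rewrite big_ord0 expn0 divr1 subrr.
rewrite big_ord_recr /= IH expnS natrM invfM.
have : (2 ^ n)%:R != 0 :> R by rewrite pnatr_eq0 expn_eq0.
by move=> h; field.
Qed.

Section cantor.
Variables (R : realType) (T : metricType R) (V : eqType) (Z : nat -> seq V).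
Variables (M sigma : nat -> R) (pt : (nat -> V) -> T) (E : set T).
Variables (s C q : R).
Hypotheses (M_gt0 : forall k, 0 < M k) (M_size : forall k, M k <= (size (Z k))%:R).
Hypothesis Z_uniq : forall k, uniq (Z k).
Hypotheses (sigma_gt0 : forall k, 0 < sigma k) (q_gt0 : 0 < q).
Hypothesis sigma_step : forall k, q * sigma k <= sigma k.+1.
Hypothesis sigma_small : forall e, 0 < e -> exists k, sigma k < e.
Hypothesis pt_in : forall b, (forall k, b k \in Z k) -> E (pt b).
Hypothesis pt_sep : forall b b' k, (forall k, b k \in Z k) ->
  (forall k, b' k \in Z k) -> mdist (pt b) (pt b') < sigma k ->
  forall j, (j < k)%N -> b j = b' j.
Hypotheses (s_gt0 : 0 < s) (C_gt0 : 0 < C).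
Hypothesis weight_le : forall k, tree_weight M k <= C * sigma k `^ s.

(* The error term [e] takes care of sets of diameter zero. *)
Let dominated_by_prefix (D e : R) (W : set T) :
  (forall k, tree_weight M k <= D * sigma k.+1 `^ s) -> 0 <= D -> 0 < e ->
  (exists2 d : R, d < sigma 0%N & (diam W <= d%:E)%E) ->
  exists p : (nat -> V) * nat,
    tree_weight M p.2 <= D * fine (diam_pow s W) + e /\
    forall b, (forall k, b k \in Z k) -> W (pt b) ->
      forall j, (j < p.2)%N -> b j = p.1 j.
Proof.
move=> hD D0 e0 [d d0 Wd].
have [b1 b1Z] := tree_branch_exists M_gt0 M_size.
have small : exists k, tree_weight M k <= e.
  have eC : 0 < (e / C) `^ s^-1 by rewrite powR_gt0 // divr_gt0.
  have [k hk] := sigma_small eC; exists k; apply: le_trans (weight_le k) _.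
  rewrite mulrC -ler_pdivlMr //; apply: le_trans (_ : ((e / C) `^ s^-1) `^ s <= _).
    by rewrite ge0_ler_powR // ?nnegrE ?ltW // sigma_gt0.
  by rewrite -powRrM mulVf ?gt_eqF // powRr1 // ltW // divr_gt0.
have nn : 0 <= D * fine (diam_pow s W).
  by rewrite mulr_ge0 // fine_ge0 // diam_pow_ge0.
(* A set that contains no branch point can be assigned any vertex deep enough to have weight at most
   [e]. *)
have [[b0 [b0Z Wb0]]|none] := pselect (exists b, (forall k, b k \in Z k) /\ W (pt b));
    last first.
  have [k hk] := small; exists (b1, k); split => /=.
    by apply: le_trans hk _; rewrite lerDr.
  by move=> b bZ Wb; exfalso; apply: none; exists b.
have W0 : W !=set0 by exists (pt b0).
have [r dr /andP[r0 rd]] := diam_finP W0 Wd.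
have agree b k : (forall k, b k \in Z k) -> W (pt b) -> r < sigma k ->
    forall j, (j < k)%N -> b j = b0 j.
  move=> bZ Wb rk; apply: pt_sep => //; apply: le_lt_trans rk.
  by rewrite -lee_fin -dr; exact: mdist_le_diam.
move: r0; rewrite le_eqVlt => /orP[/eqP r0|r0].
  have [k hk] := small; exists (b0, k); split => /=.
    by apply: le_trans hk _; rewrite lerDr.
  by move=> b bZ Wb; apply: agree => //; rewrite -r0.
(* At the first level k+1 with sigma_(k+1) <= r one still has r < sigma_k. Hence the branches
   through [W] share k coordinates, and the weight at depth k is at most D sigma_(k+1)^s <= D
   r^s. *)
have ex : exists k, sigma k <= r.
  by have [k /ltW hk] := sigma_small r0; exists k.
case: (ex_minnP ex) => -[|k] hk kmin.
  by have := le_lt_trans (le_trans hk rd) d0; rewrite ltxx.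
have rk : r < sigma k by rewrite ltNge; apply/negP => /kmin; rewrite ltnn.
exists (b0, k); split => /=; last by move=> b bZ Wb; apply: agree.
apply: le_trans (hD k) _; rewrite -[leLHS]addr0 lerD // ?(ltW e0) //.
rewrite ler_wpM2l // /diam_pow ifF; last first.
  by apply/negP => /eqP W00; move: W0; rewrite W00 => -[].
rewrite dr poweR_EFin /= ge0_ler_powR // ?nnegrE ?ltW //.
Qed.

(** Each set of a cover with small sum determines a prefix containing all its branches. The weights
    of these prefixes add up to at most 1/2, so [tree_avoid] yields a branch whose point is covered
    by none of the sets. *)
Lemma hausdorff_dim_cantor : (s%:E <= hausdorff_dim E)%E.
Proof.
rewrite leNgt; apply/negP => /hausdorff_dim_lt h.
(* The factor q^(-s) pays for comparing the weight at depth k with the scale sigma_(k+1) instead of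
   sigma_k. *)
pose D := C * (q^-1) `^ s.
have D0 : 0 < D by rewrite mulr_gt0 // powR_gt0 // invr_gt0.
have hD k : tree_weight M k <= D * sigma k.+1 `^ s.
  apply: le_trans (weight_le k) _; rewrite -mulrA ler_pM2l //.
  rewrite -powRM ?invr_ge0 ?(ltW q_gt0) ?(ltW (sigma_gt0 _)) //.
  rewrite ge0_ler_powR // ?nnegrE ?mulr_ge0 ?invr_ge0 ?(ltW s_gt0) ?(ltW q_gt0) //;
    rewrite ?(ltW (sigma_gt0 _)) //.
  by rewrite ler_pdivlMl.
(* The diameters contribute at most 1/4 to the total weight of the prefixes and the error terms at
   most 1/4. *)
have e0 : 0 < (4 * D)^-1 by rewrite invr_gt0 mulr_gt0.
have d0 : 0 < sigma 0%N / 2 by rewrite divr_gt0.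
have [U [EU Ud Ue]] := h _ _ d0 e0.
have dlt : sigma 0%N / 2 < sigma 0%N by rewrite ltr_pdivrMr // ltr_pMr // ltr1n.
have e4 i : 0 < 4^-1 / (2 ^ i.+1)%:R :> R.
  by rewrite divr_gt0 ?invr_gt0 // ltr0n expn_gt0.
have [p hp] := choice (fun i => dominated_by_prefix hD (ltW D0) (e4 i)
  (ex_intro2 (fun d : R => is_true (d < sigma 0%N))
    (fun d : R => is_true (diam (U i) <= d%:E)%E) _ dlt (Ud i))).
have fin i : diam_pow s (U i) \is a fin_num.
  rewrite ge0_fin_numE ?diam_pow_ge0 //.
  by apply: le_lt_trans (diam_pow_le (ltW s_gt0) (ltW d0) (Ud i)) _; rewrite ltry.
have sum_le n : \sum_(i < n) tree_weight M (p i).2 <= 2^-1.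
  apply: (@le_trans _ _ (\sum_(i < n) (D * fine (diam_pow s (U i)) +
      4^-1 / (2 ^ i.+1)%:R))).
    by apply: ler_sum => i _; case: (hp i).
  rewrite big_split /= -mulr_sumr.
  have : \sum_(i < n) fine (diam_pow s (U i)) <= (4 * D)^-1.
    rewrite -lee_fin; apply: le_trans Ue.
    rewrite -sumEFin; under eq_bigr do rewrite fineK //.
    rewrite -(big_mkord xpredT (fun i => diam_pow s (U i))).
    by apply: nneseries_lim_ge => i _ _; exact: diam_pow_ge0.
  move=> h1; have := @sum_geometric_half R 4^-1 n.
  rewrite invr_ge0 ler0n => /(_ isT) h2.
  have h3 : D * \sum_(i < n) fine (diam_pow s (U i)) <= 4^-1.
    apply: le_trans (ler_wpM2l (ltW D0) h1) _.
    by rewrite invfM mulrCA divff ?mulr1 // gt_eqF.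
  by apply: le_trans (lerD h3 h2) _; lra.
have th : 0 <= (2^-1 : R) < 1 by apply/andP; split; lra.
have [b [bZ hb]] := tree_avoid M_gt0 M_size Z_uniq
  (fun i => (p i).1) (kappa := fun i => (p i).2) th sum_le.
have [i _ Ui] := EU _ (pt_in bZ).
have [j jk] := hb i; apply.
by have [_] := hp i; apply.
Qed.

End cantor.

(** * One step of the cover and of the Cantor construction *)

Lemma maximal_separated (T : eqType) (r : rel T) (Y : seq T) :
  reflexive r -> symmetric r -> exists S : seq T,
  [/\ uniq S, {subset S <= Y}, {in S &, forall x y, r x y -> x = y} &
    {in Y, forall y, exists2 x, x \in S & r x y}].
Proof.
move=> rr rs; elim: Y => [|y Y [S [uS SY sep cov]]]; first by exists [::].
have [/hasP[x xS xy]|/hasPn far] := boolP (has (r^~ y) S).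
  exists S; split => // [z /SY zY|z]; first by rewrite inE zY orbT.
  by rewrite inE => /orP[/eqP ->|/cov //]; exists x.
exists (y :: S); split.
- rewrite /= uS andbT; apply/negP => /far /negP; apply; exact: rr.
- by move=> z; rewrite !inE => /orP[->//|/SY ->]; rewrite orbT.
- move=> u v; rewrite !inE => /orP[/eqP ->|uS'] /orP[/eqP ->|vS] // uv.
  + by move: (far v vS); rewrite rs uv.
  + by move: (far u uS'); rewrite uv.
  + exact: sep.
- move=> z; rewrite inE => /orP[/eqP ->|/cov [x xS xz]].
    by exists y; rewrite ?mem_head.
  by exists x => //; rewrite inE xS orbT.
Qed.

(* Locked, since the conversion test otherwise unfolds this power. *)
HB.lock Definition count_cst (R : realType) (m n : nat) : R :=
  (64 * (m + n)%:R) ^+ (m + n).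

Section steps.
Variables (R : realType) (m n : nat) (A : 'M[R]_(m, n)).
Hypotheses (m_gt0 : (0 < m)%N) (n_gt0 : (0 < n)%N).
Local Notation d := (m + n)%N.
Local Notation top := (top A).
Local Notation bot := (@bot R m n).
Local Notation box := (box A).
Implicit Types (z x : 'cV[int]_d) (r Q : R).

Let mem_box := mem_box A m_gt0 n_gt0.

Lemma topB z x : top (z - x) = top z - top x.
Proof. by rewrite topD topN. Qed.

Lemma botB z x : bot (z - x) = bot z - bot x.
Proof. by rewrite botD botN. Qed.

Let near r : rel 'cV[int]_d := fun y z => `|top (y - z)| <= r.

Let near_refl r : 0 <= r -> reflexive (near r).
Proof. by move=> r0 y; rewrite /near subrr top0 normr0. Qed.

Let near_sym r : symmetric (near r).
Proof. by move=> y z; rewrite /near -opprB topN normrN. Qed.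

(** [S] is a maximal 2r'-separated set of points near [x]. The sums (y - x) + w, with y in [S] and w
    in the small box, are distinct by separation and lie in the large one: 4r + r' <= 5r and Q' + Q
    + Q' <= 3Q'. *)
Lemma box_cover x r r' Q Q' : 0 < r' <= r -> 0 < Q <= Q' -> `|bot x| <= Q ->
  exists S : seq 'cV[int]_d,
  [/\ (size S * size (box r' Q') <= size (box (5 * r) (3 * Q')))%N,
    {in S, forall z, `|bot z| <= Q'} &
    forall z, `|top (z - x)| <= 4 * r -> `|bot z| <= Q' ->
      exists2 z', z' \in S & `|top (z - z')| <= 2 * r'].
Proof.
move=> /andP[r'0 r'r] /andP[Q0 QQ'] xQ.
have r0 := lt_le_trans r'0 r'r; have Q'0 := lt_le_trans Q0 QQ'.
pose Y := [seq z <- [seq x + y | y <- box (4 * r) (2 * Q')] | `|bot z| <= Q'].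
have r2 : 0 <= 2 * r' by rewrite mulr_ge0 ?(ltW r'0).
have [S [uS SY sep cov]] := maximal_separated Y (near_refl r2) (near_sym _).
have Sb z : z \in S -> `|bot z| <= Q' by move=> /SY; rewrite mem_filter => /andP[].
have St z : z \in S -> `|top (z - x)| <= 4 * r.
  move=> /SY; rewrite mem_filter => /andP[_ /mapP[y]].
  rewrite mem_box ?mulr_gt0 // => /andP[yr _] ->.
  by rewrite addrC addKr.
exists S; split => //; last first.
  move=> z zx zQ; have zY : z \in Y.
    rewrite mem_filter zQ /=; apply/mapP; exists (z - x); last by rewrite subrKC.
    rewrite mem_box ?mulr_gt0 // zx botB; apply: le_trans (ler_normB _ _) _; lra.
  by have [z' z'S h] := cov z zY; exists z' => //; rewrite -opprB topN normrN.
rewrite -(size_allpairs (fun y w => (y - x) + w)).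
apply: uniq_leq_size.
  apply: allpairs_uniq => //; first exact: uniq_box.
  move=> [y w] [y' w'] /allpairsP[[y1 w1] [/= yS wb [-> ->]]].
  move=> /allpairsP[[y2 w2] [/= y'S w'b [-> ->]]] /= e.
  have eq : y1 - y2 = w2 - w1.
    have e' : y1 + w1 = y2 + w2 by apply: (addIr (- x)); rewrite addrAC e addrAC.
    by apply/eqP; rewrite subr_eq addrAC eq_sym subr_eq e' addrC.
  have y12 : y1 = y2.
    apply: sep => //; rewrite /near eq topB.
    move: wb w'b; rewrite 2?mem_box // => /andP[h _] /andP[h' _].
    by apply: le_trans (ler_normB _ _) _; lra.
  by rewrite y12 in e *; congr pair; apply: addrI e.
move=> _ /allpairsP[[y w] [/= yS wb ->]].
move: wb; rewrite 2?mem_box ?mulr_gt0 // => /andP[h h'].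
rewrite topD botD botB; apply/andP; split.
  by apply: le_trans (ler_normD _ _) _; have := St y yS; lra.
apply: le_trans (ler_normD _ _) _.
have := ler_normB (bot y) (bot x); have := Sb y yS; lra.
Qed.

(** Every point of the box is within 4r' of a maximal separated subset [S], so it is a difference y
    - w with y in [S] and w in the small box. The margins r/4 and Q/2 leave room for adding up
    displacements over all levels. *)
Lemma box_separated r r' Q : 0 < r -> 0 < r' -> 0 < Q ->
  exists S : seq 'cV[int]_d,
  [/\ uniq S,
    (size (box (r / 4) (Q / 2)) <= size S * size (box (4 * r') Q))%N,
    {in S, forall y, `|top y| <= r / 4 /\ `|bot y| <= Q / 2} &
    {in S &, forall y y', y != y' -> 4 * r' < `|top (y - y')|}].
Proof.
move=> r0 r'0 Q0.
have r4 : 0 <= 4 * r' by rewrite mulr_ge0 ?(ltW r'0).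
have q4 : 0 < r / 4 by rewrite divr_gt0.
have q2 : 0 < Q / 2 by rewrite divr_gt0.
have [S [uS SY sep cov]] := maximal_separated (box (r / 4) (Q / 2))
  (near_refl r4) (near_sym _).
have Sb y : y \in S -> `|top y| <= r / 4 /\ `|bot y| <= Q / 2.
  by move=> /SY; rewrite mem_box // => /andP.
exists S; split => //; last first.
  move=> y y' yS y'S /eqP ne; rewrite ltNge; apply/negP => h.
  by apply: ne; apply: sep.
rewrite -(size_allpairs (fun y w => y - w)).
apply: uniq_leq_size; first exact: uniq_box.
move=> z zY; have [y yS yz] := cov z zY.
apply/allpairsP; exists (y, y - z); split; [exact: yS| |by rewrite /= subKr].
rewrite mem_box ?mulr_gt0 //; apply/andP; split; first exact: yz.
rewrite botB.
move: zY; rewrite mem_box // => /andP[_ h]; have [_ h'] := Sb y yS.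
by apply: le_trans (ler_normB _ _) _; lra.
Qed.

Lemma box_mono r r' Q Q' : 0 < r <= r' -> 0 < Q <= Q' ->
  (size (box r Q) <= size (box r' Q'))%N.
Proof.
move=> /andP[r0 rr'] /andP[Q0 QQ']; apply: uniq_leq_size; first exact: uniq_box.
have r'0 := lt_le_trans r0 rr'; have Q'0 := lt_le_trans Q0 QQ'.
move=> z; rewrite (mem_box z r0 Q0) (mem_box z r'0 Q'0) => /andP[h h'].
by rewrite (le_trans h) // (le_trans h').
Qed.

Local Notation count_cst := (count_cst R m n).

Let d_ge1 : 1 <= d%:R :> R.
Proof. by rewrite ler1n addn_gt0 m_gt0. Qed.

Lemma count_cst_ge1 : 1 <= count_cst.
Proof. by rewrite count_cst.unlock exprn_ege1 //; have := d_ge1; lra. Qed.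

(** The comparison of count and product costs 4 ^ d, the dilation a ^ d <= 16 ^ d. *)
Lemma box_le_cst a r Q : 1 <= a <= 16 -> 0 < r -> 0 < Q ->
  (size (box (a * r) (a * Q)))%:R <= 64 ^+ d * Nprod A r Q.
Proof.
move=> /andP[a1 a16] r0 Q0; have a0 : 0 < a by apply: lt_le_trans a1.
apply: le_trans (box_le_Nprod A (mulr_gt0 a0 r0) (mulr_gt0 a0 Q0)) _.
apply: le_trans (ler_wpM2l _ (Nprod_scale A m_gt0 a1 r0 Q0)) _.
  by rewrite exprn_ge0.
rewrite mulrA -exprMn ler_wpM2r ?(ltW (Nprod_gt0 _ _ _)) //.
by rewrite lerXn2r ?nnegrE //; lra.
Qed.

Let bounds_1_16 k : (1 <= k <= 16)%N -> 1 <= (k%:R : R) <= 16.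
Proof. by rewrite -(ler_nat R) -[(k <= 16)%N](ler_nat R). Qed.

Lemma box_cover_size (S : seq 'cV[int]_d) r r' Q : 0 < r -> 0 < r' -> 0 < Q ->
  (size S * size (box r' Q) <= size (box (5 * r) (3 * Q)))%N ->
  (size S)%:R <= count_cst * (Nprod A r Q / Nprod A r' Q).
Proof.
move=> r0 r'0 Q0; rewrite -(ler_nat R) natrM => h.
have N0 := Nprod_gt0 A r' Q.
(* Both sides are first dilated by the common factor 5, which leaves the lattice unchanged. *)
have h1 : (size (box (5 * r) (3 * Q)))%:R <= 64 ^+ d * Nprod A r Q.
  apply: le_trans (box_le_cst (a := 5) (bounds_1_16 (k := 5) isT) r0 Q0).
  by rewrite ler_nat box_mono // ?mulr_gt0 //= ?lexx // ler_wpM2r ?(ltW Q0) //; lra.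
have h2 := Nprod_le_box A r'0 Q0.
rewrite mulrA (ler_pdivlMr _ _ N0).
apply: le_trans (ler_wpM2l (ler0n _ _) h2) _.
have -> : count_cst * Nprod A r Q = d%:R ^+ d * (64 ^+ d * Nprod A r Q).
  by rewrite count_cst.unlock exprMn mulrCA mulrA.
rewrite mulrCA; apply: ler_wpM2l; first by rewrite exprn_ge0.
exact: le_trans h h1.
Qed.

(** Two inner radii are allowed because, in the Cantor construction, the constant c may decrease
    from one level to the next: r' carries the new constant and r1 the old one. *)
Lemma box_separated_size (S : seq 'cV[int]_d) r r1 r' Q :
  0 < r -> 0 < r' <= r1 -> 0 < Q ->
  (size (box (r / 4) (Q / 2)) <= size S * size (box (4 * r') Q))%N ->
  Nprod A r Q / Nprod A r1 Q <= count_cst ^+ 2 * (size S)%:R.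
Proof.
move=> r0 /andP[r'0 r'1] Q0; rewrite -(ler_nat R) natrM => h.
have r10 := lt_le_trans r'0 r'1.
have N0 := Nprod_gt0 A r1 Q.
have h1 : (size (box (4 * r') Q))%:R <= 64 ^+ d * Nprod A r1 Q.
  apply: le_trans (box_le_cst (a := 4) (bounds_1_16 (k := 4) isT) r10 Q0).
  rewrite ler_nat box_mono // ?mulr_gt0 //=; first by rewrite ler_wpM2l.
  by rewrite Q0 /= ler_peMl ?(ltW Q0) // ler1n.
have h2 : Nprod A r Q <= count_cst * (size (box (r / 4) (Q / 2)))%:R.
  have e4 (x : R) : 4 * (x / 4) = x by rewrite mulrC divfK ?pnatr_eq0.
  have p4' (x : R) : 0 < x -> 0 < x / 4 by move=> x0; rewrite divr_gt0.
  have h4 : 1 <= (4 : R) by rewrite ler1n.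
  have := Nprod_scale A m_gt0 h4 (p4' r r0) (p4' Q Q0).
  rewrite (e4 r) (e4 Q) => /le_trans; apply.
  have h2 := Nprod_le_box A (p4' r r0) (p4' Q Q0).
  have p4 : 0 <= (4 : R) ^+ d by apply: exprn_ge0.
  apply: le_trans (ler_wpM2l p4 h2) _.
  rewrite mulrA -exprMn count_cst.unlock; apply: ler_pM; rewrite ?exprn_ge0 ?mulr_ge0 //.
  - by rewrite lerXn2r ?nnegrE ?mulr_ge0 // ler_wpM2r // ler_nat.
  rewrite ler_nat box_mono // ?divr_gt0 //= ?lexx //.
  by rewrite ler_pM2l // lef_pV2 ?posrE // ler_nat.
rewrite (ler_pdivrMr _ _ N0); apply: le_trans h2 _.
rewrite expr2 -!mulrA ler_wpM2l ?(le_trans _ count_cst_ge1) //.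
apply: le_trans h _; rewrite mulrCA ler_wpM2l //.
apply: le_trans h1 _; rewrite ler_wpM2r ?(ltW N0) // count_cst.unlock.
by rewrite lerXn2r ?nnegrE ?mulr_ge0 // ler_peMr.
Qed.

(** Changing [r] alone also changes the lattice, so the comparison goes through counts of points,
    where the inclusion of boxes is available. *)
Lemma Nprod_half_le r Q : 0 < r -> 0 < Q ->
  Nprod A r Q <= count_cst ^+ 2 * Nprod A (r / 2) Q.
Proof.
move=> r0 Q0; have r20 : 0 < r / 2 by rewrite divr_gt0.
apply: le_trans (Nprod_le_box A r0 Q0) _.
have -> : count_cst ^+ 2 = count_cst * d%:R ^+ d * 64 ^+ d.
  by rewrite expr2 {2}count_cst.unlock exprMn -mulrA [X in _ = _ * X]mulrC.
rewrite -[X in _ <= X]mulrA; apply: ler_pM => //.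
  by rewrite ler_peMl ?exprn_ge0 // count_cst_ge1.
apply: le_trans (box_le_cst (a := 2) (bounds_1_16 (k := 2) isT) r20 Q0).
rewrite ler_nat box_mono // ?r0 ?Q0 //=; last by lra.
by rewrite mulrC divfK.
Qed.

Lemma Nprod_half_ge r Q : 0 < r -> 0 < Q ->
  Nprod A (r / 2) Q <= count_cst ^+ 2 * Nprod A r Q.
Proof.
move=> r0 Q0; have r20 : 0 < r / 2 by rewrite divr_gt0.
apply: le_trans (Nprod_le_box A r20 Q0) _.
have -> : count_cst ^+ 2 = count_cst * d%:R ^+ d * 64 ^+ d.
  by rewrite expr2 {2}count_cst.unlock exprMn -mulrA [X in _ = _ * X]mulrC.
rewrite -[X in _ <= X]mulrA; apply: ler_pM => //.
  by rewrite ler_peMl ?exprn_ge0 // count_cst_ge1.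
have := box_le_cst (a := 1) (bounds_1_16 (k := 1) isT) r0 Q0; rewrite !mul1r.
apply: le_trans.
by rewrite ler_nat box_mono // ?r20 ?Q0 //=; lra.
Qed.

End steps.

(** * The levels T_j and the torus *)

Section dimension_function.
Variables (R : realType) (psi : R -> R).
Hypothesis psi_gt0 : forall T : R, 0 < T -> 0 < psi T.
Hypothesis psi_cont : {in `]0, +oo[, continuous psi}.
Hypothesis psi_decr : forall S T : R, 0 < S -> S < T -> psi T < psi S.
Hypothesis psi_oo : psi T @[T --> +oo] --> (0 : R).
Hypothesis psi_0 : psi T @[T --> 0^'+] --> +oo.

Lemma psi_nonincr S T : 0 < S -> S <= T -> psi T <= psi S.
Proof.
by move=> S0; rewrite le_eqVlt => /orP[/eqP ->|/(psi_decr S0)/ltW].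
Qed.

(** The limits at 0 and at infinity bracket [y], and the intermediate value theorem applies. Thus
    [pinv] in [Tseq] returns genuine preimages. *)
Lemma psi_surj y : 0 < y -> exists2 T, 0 < T & psi T = y.
Proof.
move=> y0.
have [a [a0 ay]] : exists a, 0 < a /\ y <= psi a.
  have h : \forall t \near (0 : R)^'+, 0 < t /\ y <= psi t.
    near=> t; split; near: t; first exact: nbhs_right_gt.
    by move/cvgryPge : psi_0; apply.
  by have [a ha] := filter_ex h; exists a.
have [b ab yb] : exists2 b, a <= b & psi b <= y.
  move/cvgrPdist_lt : psi_oo => /(_ y y0) [B [_ hB]].
  exists (Num.max a (B + 1)); first by rewrite le_max lexx.
  have := hB (Num.max a (B + 1)); rewrite lt_max ltrDl ltr01 orbT => /(_ isT).
  rewrite sub0r normrN => /ltW; apply: le_trans; exact: ler_norm.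
have [T] : exists2 c, c \in `[a, b] & psi c = y.
  apply: IVT => //; last by rewrite ge_min yb orbT le_max ay.
  apply: continuous_in_subspaceT => x; rewrite inE /= in_itv /= => /andP[ax _].
  by apply: psi_cont; rewrite in_itv /= andbT (lt_le_trans a0).
by rewrite in_itv /= => /andP[aT _]; exists T => //; exact: lt_le_trans aT.
Unshelve. all: by end_near.
Qed.

Lemma psi_lt_inv S T : 0 < S -> 0 < T -> psi T < psi S -> S < T.
Proof.
by move=> S0 T0 h; rewrite ltNge; apply/negP => /(psi_nonincr T0); rewrite leNgt h.
Qed.

Section levels.
Variable L : R.
Hypothesis L_gt0 : 0 < L.
Local Notation Tj := (Tseq psi L).

Lemma TseqP j : 0 < Tj j /\ psi (Tj j) = expR (- (j%:R * L)).
Proof.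
have surj : set_surj [set T : R | 0 < T] [set y : R | 0 < y] psi.
  by move=> y /= /psi_surj[T T0 <-]; exists T.
have y0 : [set y : R | 0 < y] (expR (- (j%:R * L))) by exact: expR_gt0.
split; last by apply: (surjpK _ surj); rewrite inE.
by have := surjpinv_image_sub surj; apply; exists (expR (- (j%:R * L))).
Qed.

Lemma Tseq_gt0 j : 0 < Tj j. Proof. by case: (TseqP j). Qed.

Lemma psi_Tseq j : psi (Tj j) = expR (- (j%:R * L)).
Proof. by case: (TseqP j). Qed.

Lemma psi_TseqS j : psi (Tj j.+1) = expR (- L) * psi (Tj j).
Proof. by rewrite !psi_Tseq -expRD -natr1; congr expR; ring. Qed.

Lemma Tseq_lt j : Tj j < Tj j.+1.
Proof.
apply: psi_lt_inv; rewrite ?Tseq_gt0 // psi_TseqS gtr_pMl ?psi_gt0 ?Tseq_gt0 //.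
by rewrite expR_lt1 oppr_lt0.
Qed.

Lemma Tseq_homo i j : (i <= j)%N -> Tj i <= Tj j.
Proof.
elim: j => [|j IH]; first by rewrite leqn0 => /eqP ->.
rewrite leq_eqVlt ltnS => /orP[/eqP -> //|/IH /le_trans]; apply.
exact/ltW/Tseq_lt.
Qed.

Lemma expR_small (e : R) : 0 < e ->
  exists J, forall j, (J <= j)%N -> expR (- (j%:R * L)) < e.
Proof.
move=> e0; pose J := Num.bound (`|ln e| / L); exists J => j Jj.
have : `|ln e| / L < j%:R.
  apply: lt_le_trans (archi_boundP _) _; first by rewrite divr_ge0 // ltW.
  by rewrite ler_nat.
rewrite ltr_pdivrMr // => h.
rewrite -[ltRHS]lnK ?posrE // ltr_expR.
have := ler_norm (- ln e); rewrite normrN; lra.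
Qed.

Lemma Tseq_unbounded x : exists J, forall j, (J <= j)%N -> x < Tj j.
Proof.
pose y := Num.max x 1.
have y0 : 0 < y by rewrite lt_max ltr01 orbT.
have [J hJ] := expR_small (psi_gt0 y0); exists J => j Jj.
apply: (@le_lt_trans _ _ y); first by rewrite le_max lexx.
by apply: psi_lt_inv; rewrite ?Tseq_gt0 // psi_Tseq hJ.
Qed.

Lemma Tseq_interval J T : Tj J <= T -> exists2 j, (J <= j)%N & Tj j <= T < Tj j.+1.
Proof.
move=> JT; have ex : exists j, T < Tj j.
  by have [j hj] := Tseq_unbounded T; exists j; exact: hj.
case: (ex_minnP ex) => -[|j] hj jmin.
  by have := Tseq_homo (leq0n J); rewrite leNgt (le_lt_trans JT hj).
exists j.
  rewrite -ltnS ltnNge; apply/negP => jJ.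
  by have := Tseq_homo jJ; rewrite leNgt (le_lt_trans JT hj).
by rewrite hj andbT leNgt; apply/negP => /jmin; rewrite ltnn.
Qed.

End levels.

Hypothesis psi_lqm : lower_quasimultiplicative psi.

(** With r = max (R0, 2) and L > tau ln r, one has psi (r T_j) >= r^(-tau) psi (T_j) > e^(-L) psi
    (T_j) = psi (T_(j+1)), so r T_j < T_(j+1). *)
Lemma Tseq_double : exists2 L0 : R, 0 < L0 & forall L, L0 <= L ->
  exists J, forall j, (J <= j)%N -> 2 * Tseq psi L j <= Tseq psi L j.+1.
Proof.
have [tau [R0 [tau0 R01 [M [_ hM]]]]] := psi_lqm.
pose r := Num.max R0 2.
have r2 : 2 <= r by rewrite le_max lexx orbT.
have r0 : 0 < r by apply: lt_le_trans r2.
exists (tau * ln r + 1).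
  by rewrite ltr_wpDl // mulr_ge0 ?(ltW tau0) // ln_ge0 // (le_trans _ r2) // ler1n.
move=> L LL0.
have L0 : 0 < L.
  apply: lt_le_trans LL0; rewrite ltr_wpDl // mulr_ge0 ?(ltW tau0) //.
  by rewrite ln_ge0 // (le_trans _ r2) // ler1n.
have [J hJ] := Tseq_unbounded L0 M; exists J => j Jj.
have Tj0 := Tseq_gt0 L j.
apply: (@le_trans _ _ (r * Tseq psi L j)); first by rewrite ler_wpM2r // ltW.
apply/ltW/psi_lt_inv; rewrite ?mulr_gt0 ?Tseq_gt0 //.
apply: lt_le_trans (hM _ (hJ j Jj) r _); last by rewrite le_max lexx.
rewrite psi_TseqS ltr_pM2r ?psi_gt0 // /powR gt_eqF // ltr_expR.
by rewrite mulNr ltrN2; apply: lt_le_trans LL0; rewrite ltrDl.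
Qed.

End dimension_function.

Section torus_facts.
Variables (R : realType) (m : nat).
Implicit Types (x y : 'cV[R]_m) (b : torus R m) (r : R).

Lemma repr_pi_torus x : exists p, repr (\pi_(torus R m)%qT x) = x + intmx p.
Proof.
have /eqmodP/torus_equivP[p hp] : \pi_(torus R m)%qT (repr (\pi_(torus R m)%qT x)) =
  \pi_(torus R m)%qT x by rewrite reprK.
by exists p; rewrite -hp addrC subrK.
Qed.

Lemma torus_mdist_le b b' p : mdist b b' <= `|repr b - repr b' - intmx p|.
Proof.
rewrite /mdist /=; apply: ge_inf; last by exists p.
by exists 0 => _ [q _ <-].
Qed.

(** Here |x - y| <= 1/2, and a nonzero integer translation moves some coordinate by at least 1,
    leaving it at distance at least 1/2 from 0. *)
Lemma torus_mdist_pi x y r : `|x| <= 4^-1 -> `|y| <= 4^-1 -> r <= `|x - y| ->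
  r <= mdist (\pi_(torus R m)%qT x) (\pi_(torus R m)%qT y).
Proof.
move=> x4 y4 rxy; apply: lb_le_inf.
  by exists `|repr (\pi_(torus R m)%qT x) - repr (\pi_(torus R m)%qT y) - intmx 0|; exists 0.
move=> _ [p _ <-]; apply: le_trans rxy _.
have [px ->] := repr_pi_torus x; have [py ->] := repr_pi_torus y.
have -> : x + intmx px - (y + intmx py) - intmx p =
    x - y - intmx (p + py - px) :> 'cV[R]_m.
  by apply/matrixP => i j; rewrite !mxE rmorphB rmorphD /=; ring.
set q := p + py - px.
have xy2 : `|x - y| <= 2^-1 by apply: le_trans (ler_normB _ _) _; lra.
have [->|q0] := eqVneq q 0; first by rewrite intmx0 subr0.
have [i qi] : exists i, q i 0 != 0.
  apply/existsP; apply: contra_neqT q0 => /existsPn h.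
  by apply/matrixP => i j; rewrite (ord1 j) [RHS]mxE; apply/eqP/negPn/h.
apply: (le_trans xy2); apply: le_trans (cv_norm_ge _ i).
have : 1 <= `|(intmx q : 'cV[R]_m) i 0|.
  by rewrite mxE -intr_norm ler1z -gtz0_ge1 normr_gt0.
have := cv_norm_ge (x - y) i; rewrite [(x - y - intmx q) i 0]mxE [(- intmx q) i 0]mxE.
move: ((x - y) i 0) ((intmx q : 'cV[R]_m) i 0) => u v.
move=> h1 h2; rewrite [leRHS]distrC; have := lerB_dist v u. lra.
Qed.

End torus_facts.

(** * Reduction of D to the discrete levels T_j *)

Section discretization.
Variables (R : realType) (m n : nat) (A : 'M[R]_(m, n)) (psi : R -> R).
Hypothesis psi_gt0 : forall T : R, 0 < T -> 0 < psi T.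
Hypothesis psi_cont : {in `]0, +oo[, continuous psi}.
Hypothesis psi_decr : forall S T : R, 0 < S -> S < T -> psi T < psi S.
Hypothesis psi_oo : psi T @[T --> +oo] --> (0 : R).
Hypothesis psi_0 : psi T @[T --> 0^'+] --> +oo.
Variable L : R.
Hypothesis L_gt0 : 0 < L.
Local Notation Tj := (Tseq psi L).
Local Notation rj := (fun j : nat => expR (- (j%:R * L))).

Definition approximable (b : torus R m) (r Q : R) :=
  exists z : 'cV[int]_(m + n), `|top A z - repr b| <= r /\ `|bot R z| <= Q.

Lemma D_approximable c b : D A (scale c psi) b ->
  exists J, forall j, (J <= j)%N -> approximable b (c * rj j) (Tj j).
Proof.
move=> [M [_ hM]].
have [J hJ] := Tseq_unbounded psi_gt0 psi_cont psi_decr psi_oo psi_0 L_gt0 M.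
exists J => j Jj; have [p [q []]] := hM _ (hJ j Jj).
rewrite /scale psi_Tseq // => h1 h2; exists (col_mx (- p) q).
rewrite /top /bot col_mxKu col_mxKd; split => //.
by rewrite intmxN [- _ + _]addrC.
Qed.

(** For T between T_j and T_(j+1), psi T is at least e^(-L) psi (T_j); this is the loss of a factor
    e^L. The constants depend on j so that the lemma also serves for [Sing]. *)
Lemma approximable_D c (c' : nat -> R) b J :
  (forall j, (J <= j)%N -> approximable b (c' j * rj j) (Tj j)) ->
  (forall j, (J <= j)%N -> c' j * expR L <= c) ->
  D A (scale c psi) b.
Proof.
move=> hb hc; exists (Tj J); split; first exact: num_real.
move=> T /ltW /(Tseq_interval psi_gt0 psi_cont psi_decr psi_oo psi_0 L_gt0).
move=> [j Jj /andP[jT Tj']].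
have [z [h1 h2]] := hb j Jj.
exists (- usubmx z), (dsubmx z); split; last exact: le_trans h2 jT.
have -> : A *m intmx (dsubmx z) - intmx (- usubmx z) - repr b = top A z - repr b.
  by rewrite intmxN opprK /top; congr (_ - _); exact: addrC.
have Tj0 : 0 < Tj j by apply: Tseq_gt0.
have T0 := lt_le_trans Tj0 jT.
have c'0 : 0 <= c' j.
  by rewrite -(pmulr_lge0 _ (expR_gt0 (- (j%:R * L)))); apply: le_trans h1.
apply: (le_trans h1); apply: (@le_trans _ _ (c' j * expR L * psi T)); last first.
  by rewrite /scale ler_wpM2r ?hc // ltW // psi_gt0.
rewrite -mulrA ler_wpM2l //.
have : psi (Tj j.+1) <= psi T by rewrite (psi_nonincr psi_decr) // ltW.
rewrite psi_TseqS // psi_Tseq // => h.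
rewrite -ler_pdivrMl ?expR_gt0 // -expRN; exact: h.
Qed.

End discretization.

(** * Upper bound *)

Section liminf.
Variable R : realType.
Implicit Types (u : nat -> \bar R) (x : \bar R).

Lemma limn_einfE u : limn_einf u = ereal_sup (range (einfs u)).
Proof. by rewrite limn_einf_lim; apply/cvg_lim => //; exact: cvg_einfs_sup. Qed.

Lemma limn_einf_ltP u x : (limn_einf u < x)%E ->
  forall N, exists2 k, (N <= k)%N & (u k < x)%E.
Proof.
move=> ux N.
have : (einfs u N < x)%E.
  apply: le_lt_trans ux; rewrite limn_einfE.
  by apply: ereal_sup_ubound; exists N.
by move/ereal_inf_lt => [_ [k /= Nk <-] h]; exists k.
Qed.

Lemma limn_einf_gtP u x : (x < limn_einf u)%E ->
  exists N, forall k, (N <= k)%N -> (x < u k)%E.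
Proof.
rewrite limn_einfE => /ereal_sup_gt[_ [N _ <-] h]; exists N => k Nk.
by apply: lt_le_trans h _; apply: ereal_inf_lbound; exists k.
Qed.

Lemma limn_einf_ge u x N : (forall k, (N <= k)%N -> (x <= u k)%E) ->
  (x <= limn_einf u)%E.
Proof.
move=> h; rewrite limn_einfE; apply: le_trans (_ : einfs u N <= _)%E.
  by apply: le_ereal_inf_tmp => _ [k /= Nk <-]; exact: h.
by apply: ereal_sup_ubound; exists N.
Qed.

End liminf.

HB.lock Definition log_branching (R : realType) (m n : nat) (A : 'M[R]_(m, n))
    (psi : R -> R) (L c : R) (j : nat) : R :=
  ln (Nprod A (c * psi (Tseq psi L j)) (Tseq psi L j.+1) /
      Nprod A (c * psi (Tseq psi L j.+1)) (Tseq psi L j.+1)).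

Section pressure_sums.
Variables (R : realType) (m n : nat) (A : 'M[R]_(m, n)) (psi : R -> R).
Implicit Types (L c s : R).

Local Notation log_branching := (log_branching A psi).

Definition branching_sum L c (N : nat) := \sum_(0 <= j < N) log_branching L c j.

Lemma expR_log_branching L c j : expR (log_branching L c j) =
  Nprod A (c * psi (Tseq psi L j)) (Tseq psi L j.+1) /
  Nprod A (c * psi (Tseq psi L j.+1)) (Tseq psi L j.+1).
Proof. by rewrite log_branching.unlock lnK // posrE divr_gt0 // Nprod_gt0. Qed.

Lemma pressureE L c : pressure A psi L c =
  limn_einf (fun N : nat => ((N%:R * L)^-1 * branching_sum L c N)%:E).
Proof. by rewrite /branching_sum log_branching.unlock. Qed.

Lemma pressure_lt L c s : 0 < L -> (pressure A psi L c < s%:E)%E ->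
  forall N0, exists2 N, (N0 <= N)%N & branching_sum L c N <= s * (N%:R * L).
Proof.
move=> L0; rewrite pressureE => /limn_einf_ltP h N0.
have [N NN0] := h N0.+1; rewrite lte_fin mulrC ltr_pdivrMr; last first.
  by rewrite mulr_gt0 // ltr0n (leq_ltn_trans _ NN0).
by move=> /ltW hN; exists N => //; exact: ltnW.
Qed.

Lemma pressure_gt L c s : 0 < L -> (s%:E < pressure A psi L c)%E ->
  exists N0, forall N, (N0 <= N)%N -> s * (N%:R * L) <= branching_sum L c N.
Proof.
move=> L0; rewrite pressureE => /limn_einf_gtP[N0 h]; exists N0.+1 => N NN0.
have := h N (ltnW NN0); rewrite lte_fin mulrC ltr_pdivlMr; last first.
  by rewrite mulr_gt0 // ltr0n (leq_ltn_trans _ NN0).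
exact: ltW.
Qed.

Lemma pressure_ge L c s : 0 < L ->
  (forall N, s * (N%:R * L) <= branching_sum L c N) ->
  (s%:E <= pressure A psi L c)%E.
Proof.
move=> L0 h; rewrite pressureE; apply: (@limn_einf_ge _ _ _ 1%N) => N N1.
rewrite lee_fin [leRHS]mulrC ler_pdivlMr; first exact: h.
by rewrite mulr_gt0 // ltr0n.
Qed.

End pressure_sums.

Lemma size_flatten_le (R : realDomainType) (T U : eqType) (s : seq T)
    (F : T -> seq U) (B : R) :
  {in s, forall x, (size (F x))%:R <= B} ->
  (size (flatten [seq F x | x <- s]))%:R <= (size s)%:R * B.
Proof.
elim: s => [_|x s IH h]; first by rewrite mul0r.
rewrite /= size_cat natrD -natr1 mulrDl mul1r addrC lerD //.
  by apply: IH => y ys; apply: h; rewrite inE ys orbT.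
by apply: h; exact: mem_head.
Qed.

Lemma hausdorff_null_finite (R : realType) (T : metricType R) (E : set T) (s : R) :
  0 <= s ->
  (forall delta eps : R, 0 < delta -> 0 < eps ->
    exists (k : nat) (W : nat -> set T) (r : R),
    [/\ E `<=` \bigcup_(i < k) W i, forall i x y, W i x -> W i y -> mdist x y <= r,
        0 <= r <= delta & k%:R * r `^ s <= eps]) ->
  hausdorff_null s E.
Proof.
move=> s0 h delta eps d0 e0; have [k [W [r [EW Wr /andP[r0 rd] kr]]]] := h _ _ d0 e0.
(* The finite cover is padded with empty sets, which weigh 0 even for exponent 0. *)
pose U i := if (i < k)%N then W i else set0.
have U_diam i : (diam (U i) <= r%:E)%E.
  apply: diam_le => x y; rewrite /U; case: ifP => // _; exact: Wr.
exists U; split.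
- by move=> x /EW[i /= ik Wx]; exists i => //; rewrite /U ik.
- by move=> i; apply: le_trans (U_diam i) _; rewrite lee_fin.
rewrite (@nneseries_split _ _ 0 k); last by move=> *; exact: diam_pow_ge0.
rewrite add0n [X in (_ + X)%E]eseries0 ?adde0; last first.
  by move=> i ki _; rewrite /U ltnNge ki /= diam_pow0.
apply: le_trans (_ : (k%:R * r `^ s)%:E <= _)%E; last by rewrite lee_fin.
apply: (@le_trans _ _ (\sum_(0 <= i < k) (r `^ s)%:E)%E).
  by apply: lee_sum => i _; exact: diam_pow_le.
by rewrite sumEFin lee_fin big_const_nat subn0 iter_addr_0 mulr_natl.
Qed.

Lemma powR_expR (R : realType) (x s : R) : expR x `^ s = expR (x * s).
Proof. by rewrite /powR gt_eqF ?expR_gt0 // expRK mulrC. Qed.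

Section upper_bound.
Variables (R : realType) (m n : nat) (A : 'M[R]_(m, n)) (psi : R -> R).
Hypotheses (m_gt0 : (0 < m)%N) (n_gt0 : (0 < n)%N).
Hypothesis psi_gt0 : forall T : R, 0 < T -> 0 < psi T.
Hypothesis psi_cont : {in `]0, +oo[, continuous psi}.
Hypothesis psi_decr : forall S T : R, 0 < S -> S < T -> psi T < psi S.
Hypothesis psi_oo : psi T @[T --> +oo] --> (0 : R).
Hypothesis psi_0 : psi T @[T --> 0^'+] --> +oo.
Variables (L c : R).
Hypotheses (L_gt0 : 0 < L) (c_gt0 : 0 < c).
Local Notation Tj := (Tseq psi L).
Local Notation K := (count_cst R m n).
Local Notation bot := (@bot R m n).

Let Tj_gt0 j : 0 < Tj j. Proof. exact: Tseq_gt0. Qed.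
Let cpsi_gt0 j : 0 < c * psi (Tj j). Proof. by rewrite mulr_gt0 ?psi_gt0. Qed.
Let psi_S j : psi (Tj j.+1) <= psi (Tj j).
Proof. by apply: psi_nonincr => //; apply/ltW/Tseq_lt. Qed.
Let Tj_S j : Tj j <= Tj j.+1. Proof. by apply/ltW/Tseq_lt. Qed.
Let cpsi_S j : c * psi (Tj j.+1) <= c * psi (Tj j).
Proof. by rewrite ler_pM2l. Qed.
Let K_gt0 : 0 < K.
Proof. exact: lt_le_trans (count_cst_ge1 R n m_gt0). Qed.

(** Only the class of [top A x] modulo integers matters, so finitely many [x] suffice at the
    starting level. *)
Definition near_torus (r : R) (b : torus R m) (x : 'cV[int]_(m + n)) :=
  exists p, `|top A x + intmx p - repr b| <= r.

Lemma near_torus_diam r b b' x : near_torus r b x -> near_torus r b' x ->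
  mdist b b' <= 2 * r.
Proof.
move=> [p hp] [p' hp']; apply: le_trans (torus_mdist_le b b' (p - p')) _.
have -> : repr b - repr b' - intmx (p - p') =
    (top A x + intmx p' - repr b') - (top A x + intmx p - repr b).
  by apply/matrixP => i j; rewrite !mxE rmorphB /=; ring.
by apply: le_trans (ler_normB _ _) _; lra.
Qed.

(** The cover supplied by [box_cover] around the origin is nonempty. The bound makes the pressure
    plus ln K / L nonnegative, as an upper bound for a dimension must be. *)
Lemma log_branching_ge j : - ln K <= log_branching A psi L c j.
Proof.
have h0 : 0 < c * psi (Tj j.+1) <= c * psi (Tj j) by rewrite cpsi_gt0 cpsi_S.
have h1 : 0 < Tj j <= Tj j.+1 by rewrite Tj_gt0 Tj_S.
have h2 : `|bot 0| <= Tj j by rewrite bot0 normr0 ltW.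
have [S [szS _ cov]] := box_cover A m_gt0 n_gt0 h0 h1 h2.
have [|z zS _] := cov 0 _ (le_trans h2 (Tj_S j)).
  by rewrite subrr top0 normr0 mulr_ge0 // ltW.
have := box_cover_size m_gt0 n_gt0 (cpsi_gt0 j) (cpsi_gt0 j.+1) (Tj_gt0 j.+1) szS.
rewrite -expR_log_branching => h.
have : 1 <= K * expR (log_branching A psi L c j).
  by apply: le_trans h; rewrite ler1n; case: (S) zS.
rewrite -[K]lnK ?posrE // -expRD -[leLHS]expR0 ler_expR lnK ?posrE //; lra.
Qed.

Section from_level.
Variable J : nat.

Let F : set (torus R m) :=
  [set b | forall j, (J <= j)%N -> approximable A b (c * psi (Tj j)) (Tj j)].

Let bound N := N%:R * ln K + branching_sum A psi L c N.

(** By induction on [k], each center is replaced by the at most K e^(log_branching) centers that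
    [box_cover] provides at the next level. *)
Lemma cover_from_level k : exists X : seq 'cV[int]_(m + n),
  [/\ {in X, forall x, `|bot x| <= Tj (J + k)},
    (size X)%:R <= (size (box A 1 (Tj J)))%:R * expR (bound (J + k) - bound J) &
    forall b, F b -> exists2 x, x \in X & near_torus (3 * (c * psi (Tj (J + k)))) b x].
Proof.
elim: k => [|k [X [Xb Xs Xc]]].
  rewrite addn0 subrr expR0 mulr1; exists (box A 1 (Tj J)); split => //.
    by move=> x; rewrite (mem_box A m_gt0 n_gt0 x ltr01 (Tj_gt0 J)) => /andP[].
  move=> b /(_ J (leqnn J)) [z [h1 h2]].
  (* Removing the integer part brings the top component into the unit box. *)
  pose p : 'cV[int]_m := map_mx Num.floor (top A z).
  exists (z - shift_top n p); last first.
    exists p; rewrite topB top_shift subrK; apply: (le_trans h1).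
    by rewrite ler_peMl ?(ltW (cpsi_gt0 J)) // ler1n.
  rewrite (mem_box A m_gt0 n_gt0 _ ltr01 (Tj_gt0 J)) topB botB top_shift bot_shift.
  rewrite subr0 h2 andbT; apply/cv_norm_leP => // i.
  move: (top A z) @p => y p; rewrite !mxE.
  have /andP[] := floor_itv (y i 0); rewrite intrD mulr1z => y1 y2.
  by rewrite ger0_norm ?subr_ge0 //; lra.
rewrite addnS; set N := (J + k)%N in Xb Xs Xc *.
have h0 : 0 < c * psi (Tj N.+1) <= c * psi (Tj N) by rewrite cpsi_gt0 cpsi_S.
have h1 : 0 < Tj N <= Tj N.+1 by rewrite Tj_gt0 Tj_S.
have ex (x : 'cV[int]_(m + n)) : exists S : seq 'cV[int]_(m + n), `|bot x| <= Tj N ->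
  [/\ (size S * size (box A (c * psi (Tj N.+1)) (Tj N.+1)) <=
       size (box A (5 * (c * psi (Tj N))) (3 * Tj N.+1)))%N,
    {in S, forall z, `|bot z| <= Tj N.+1} &
    forall z, `|top A (z - x)| <= 4 * (c * psi (Tj N)) -> `|bot z| <= Tj N.+1 ->
      exists2 z', z' \in S & `|top A (z - z')| <= 2 * (c * psi (Tj N.+1))].
  have [xb|] := pselect (`|bot x| <= Tj N); last by exists [::].
  by have [S hS] := box_cover A m_gt0 n_gt0 h0 h1 xb; exists S.
have [G hG] := choice ex.
exists (flatten [seq G x | x <- X]); split.
- by move=> z /flatten_mapP[x /Xb/hG[_ + _]]; apply.
- apply: (@le_trans _ _ ((size X)%:R * (K * expR (log_branching A psi L c N)))).
    apply: size_flatten_le => x /Xb/hG[szG _ _]; rewrite expR_log_branching.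
    exact: box_cover_size szG.
  apply: le_trans (ler_wpM2r _ Xs) _.
    by rewrite mulr_ge0 ?expR_ge0 // ltW.
  rewrite -mulrA ler_wpM2l // -[X in _ * (X * _) <= _](lnK (x := K)) ?posrE //.
  rewrite -!expRD ler_expR /bound -natr1 /branching_sum big_nat_recr //=; lra.
(* With r and r' the old and new radii: [b] is within 3r of [x] and r' <= r of a new point z, so z
   is within 4r of [x]. Some y of the cover is within 2r' of z, hence within 3r' of [b]. *)
- move=> b Fb; have [x xX [p hp]] := Xc b Fb.
  have [_ _ cov] := hG x (Xb x xX).
  have NJ : (J <= N.+1)%N by rewrite leqW // leq_addr.
  have [z [z1 z2]] := Fb N.+1 NJ.
  have [||y yG hy] := cov (z - shift_top n p).
  + have -> : top A (z - shift_top n p - x) =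
        (top A z - repr b) - (top A x + intmx p - repr b).
      by rewrite !topB top_shift; apply/matrixP => i j; rewrite !mxE; ring.
    apply: le_trans (ler_normB _ _) _; have := cpsi_S N; lra.
  + by rewrite botB bot_shift subr0.
  exists y; first by apply/flatten_mapP; exists x.
  exists p.
  have -> : top A y + intmx p - repr b =
      (top A z - repr b) - top A (z - shift_top n p - y).
    by rewrite !topB top_shift; apply/matrixP => i j; rewrite !mxE; ring.
  apply: le_trans (ler_normB _ _) _; lra.
Qed.

(** The lower limit gives arbitrarily large N with branching sum at most s' N L. At these levels the
    number of sets times diameter^s is at most B e^(- N eta), with eta = L (s - s') - ln K > 0. *)
Lemma null_from_level s s' : 0 <= s -> (pressure A psi L c < s'%:E)%E ->
  s' + ln K / L < s -> hausdorff_null s F.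
Proof.
move=> s0 Ps' s's; apply: hausdorff_null_finite => // delta eps d0 e0.
pose eta := L * (s - s') - ln K.
have eta0 : 0 < eta.
  have : L * (s' + ln K / L) < L * s by rewrite ltr_pM2l.
  rewrite mulrDr [L * (ln K / L)]mulrC divfK ?gt_eqF // /eta; lra.
pose B := (size (box A 1 (Tj J)))%:R * expR (- bound J) * (6 * c) `^ s + 1.
have B0 : 0 < B.
  by rewrite ltr_wpDl // !mulr_ge0 ?expR_ge0 ?powR_ge0.
have [N1 hN1] := expR_small eta0 (divr_gt0 e0 B0).
have c60 : 0 < 6 * c by rewrite mulr_gt0.
have [N2 hN2] := expR_small L_gt0 (divr_gt0 d0 c60).
have [N + SN] := pressure_lt L_gt0 Ps' (maxn (maxn N1 N2) J).
rewrite !geq_max => /andP[/andP[N1N N2N] JN].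
have := cover_from_level (N - J); rewrite subnKC // => -[X [_ Xs Xc]].
exists (size X), (fun i => [set b | near_torus (3 * (c * psi (Tj N))) b X`_i]).
exists (6 * (c * psi (Tj N))); split.
- move=> b /Xc[x xX bx]; exists (index x X); rewrite /= ?index_mem //.
  by rewrite nth_index.
- move=> i b b' /= h h'; apply: le_trans (near_torus_diam h h') _; lra.
- rewrite mulr_ge0 ?(ltW (cpsi_gt0 N)) //= psi_Tseq // mulrA.
  have := hN2 N N2N; rewrite ltr_pdivlMr // mulrC; exact: ltW.
rewrite psi_Tseq // mulrA powRM ?expR_ge0 ?(ltW c60) // powR_expR.
apply: le_trans (ler_wpM2r _ Xs) _; first by rewrite mulr_ge0 ?powR_ge0 ?expR_ge0.
apply: (@le_trans _ _ (B * expR (- (N%:R * eta)))); last first.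
  by have := hN1 N N1N; rewrite ltr_pdivlMr // mulrC; exact: ltW.
have -> : (size (box A 1 (Tj J)))%:R * expR (bound N - bound J) *
    ((6 * c) `^ s * expR (- (N%:R * L) * s)) =
    ((size (box A 1 (Tj J)))%:R * expR (- bound J) * (6 * c) `^ s) *
    expR (bound N - N%:R * L * s).
  rewrite -!mulrA; congr (_ * _); rewrite [RHS]mulrCA [LHS]mulrCA; congr (_ * _).
  by rewrite -!expRD; congr expR; ring.
apply: ler_pM; rewrite ?expR_ge0 ?mulr_ge0 ?powR_ge0 ?expR_ge0 //.
  by rewrite /B lerDl.
rewrite ler_expR /bound /eta.
have -> : - (N%:R * (L * (s - s') - ln K)) =
  N%:R * ln K + s' * (N%:R * L) - N%:R * L * s by ring.
by rewrite lerD2r lerD2l.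
Qed.

End from_level.

Lemma hausdorff_dim_D_le : (hausdorff_dim (D A (scale c psi)) <=
  pressure A psi L c + (ln K / L)%:E)%E.
Proof.
have Pge : ((- (ln K / L))%:E <= pressure A psi L c)%E.
  apply: pressure_ge => // N; rewrite mulNr mulrCA divfK ?gt_eqF //.
  rewrite /branching_sum -mulrN -[X in X%:R]subn0 mulr_natl -sumr_const_nat.
  by apply: ler_sum => j _; exact: log_branching_ge.
move: Pge; case P : (pressure A psi L c) => [p| |] //; last first.
  by move=> _; rewrite addye // leey.
rewrite lee_fin -EFinD => Pge; apply: hausdorff_dim_le_lt => [|s].
  by rewrite lee_fin; lra.
rewrite lte_fin => ps.
apply: (@hausdorff_null_subset _ _ _ _ (\bigcup_J
  [set b | forall j, (J <= j)%N -> approximable A b (c * psi (Tj j)) (Tj j)])).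
  move=> b /(D_approximable psi_gt0 psi_cont psi_decr psi_oo psi_0 L_gt0)[J hJ].
  by exists J => // j /hJ; rewrite psi_Tseq.
apply: hausdorff_null_bigcup => J.
(* The exponent is the midpoint of p and s - ln K / L. *)
apply: (@null_from_level J s ((p + s - ln K / L) / 2)); first by lra.
  by rewrite P lte_fin; lra.
by lra.
Qed.

End upper_bound.

(** * Lower bound *)

(** The intervals of center [a k] and radius [rho k] are nested; the supremum of their left ends
    belongs to all of them. *)
Lemma nested_limit_real (R : realType) (a rho : nat -> R) J :
  (forall k, 0 <= rho k) ->
  (forall k, (J <= k)%N -> `|a k.+1 - a k| + rho k.+1 <= rho k) ->
  exists x, forall k, (J <= k)%N -> `|x - a k| <= rho k.
Proof.
move=> rho0 h.
have mono i k : (J <= k)%N -> `|a (k + i)%N - a k| + rho (k + i)%N <= rho k.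
  move=> Jk; elim: i => [|i IH]; first by rewrite addn0 subrr normr0 add0r.
  have h1 := h (k + i)%N (leq_trans Jk (leq_addr _ _)); rewrite addnS.
  have h2 := ler_distD (a (k + i)%N) (a (k + i).+1) (a k).
  lra.
have cross k l : (J <= k)%N -> (J <= l)%N -> a k - rho k <= a l + rho l.
  move=> Jk Jl; have r1 := rho0 k; have r2 := rho0 l.
  have [kl|lk] := leqP k l.
    have := mono (l - k)%N k Jk; rewrite subnKC // => h1.
    have := ler_norm (a k - a l); rewrite distrC; lra.
  have := mono (k - l)%N l Jl; rewrite subnKC 1?ltnW // => h1.
  have := ler_norm (a k - a l); lra.
pose S : set R := [set a k - rho k | k in [set k | (J <= k)%N]].
have Sub k : (J <= k)%N -> ubound S (a k + rho k).
  by move=> Jk _ [l /= Jl <-]; apply: cross.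
have S0 : S !=set0 by exists (a J - rho J); exists J => /=.
exists (sup S) => k Jk; rewrite ler_distl; apply/andP; split.
  by apply: ub_le_sup; [exists (a J + rho J); exact: Sub | exists k].
by apply: sup_le_ub => //; exact: Sub.
Qed.

Lemma nested_limit (R : realType) m (X : nat -> 'cV[R]_m) (rho : nat -> R) J :
  (forall k, 0 <= rho k) ->
  (forall k, (J <= k)%N -> `|X k.+1 - X k| + rho k.+1 <= rho k) ->
  exists x, forall k, (J <= k)%N -> `|x - X k| <= rho k.
Proof.
move=> rho0 h.
have ex (i : 'I_m) : exists x, forall k, (J <= k)%N -> `|x - X k i 0| <= rho k.
  apply: nested_limit_real => // k Jk; apply: le_trans (h k Jk).
  rewrite lerD2r; have := cv_norm_ge (X k.+1 - X k) i.
  by rewrite [(X k.+1 - X k) i 0]mxE [(- X k) i 0]mxE.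
have [x hx] := choice ex; exists (\col_i x i) => k Jk.
apply/cv_norm_leP => // i; rewrite [(_ - X k) i 0]mxE [(- X k) i 0]mxE mxE.
exact: hx.
Qed.

Section lower_bound.
Variables (R : realType) (m n : nat) (A : 'M[R]_(m, n)) (psi : R -> R).
Hypotheses (m_gt0 : (0 < m)%N) (n_gt0 : (0 < n)%N).
Hypothesis psi_gt0 : forall T : R, 0 < T -> 0 < psi T.
Hypothesis psi_cont : {in `]0, +oo[, continuous psi}.
Hypothesis psi_decr : forall S T : R, 0 < S -> S < T -> psi T < psi S.
Hypothesis psi_oo : psi T @[T --> +oo] --> (0 : R).
Hypothesis psi_0 : psi T @[T --> 0^'+] --> +oo.
Variables (L : R) (J0 : nat) (c : nat -> R).
Hypothesis L_ge1 : 1 <= L.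
Local Notation Tj := (Tseq psi L).
Local Notation K := (count_cst R m n).
Local Notation bot := (@bot R m n).
Local Notation V := 'cV[int]_(m + n).
Hypothesis Tj_double : forall j, (J0 <= j)%N -> 2 * Tj j <= Tj j.+1.
Hypothesis c_gt0 : forall j, 0 < c j.
Hypothesis c_nonincr : forall j, c j.+1 <= c j.
Hypothesis c_half : forall j, c j / 2 <= c j.+1.

Let L_gt0 : 0 < L. Proof. exact: lt_le_trans L_ge1. Qed.
Let Tj_gt0 j : 0 < Tj j. Proof. exact: Tseq_gt0. Qed.
Let sigma j := c j * psi (Tj j).
Let sigma_gt0 j : 0 < sigma j. Proof. by rewrite mulr_gt0 ?psi_gt0. Qed.
Let expRNL_half : expR (- L) <= 2^-1.
Proof.
rewrite expRN lef_pV2 ?posrE ?expR_gt0 //.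
by have := expR_ge1Dx L; have := L_ge1; lra.
Qed.
Let sigma_S j : sigma j.+1 <= sigma j / 2.
Proof.
rewrite /sigma psi_TseqS // -[leRHS]mulrA; apply: ler_pM => //.
- exact: ltW.
- by rewrite mulr_ge0 ?expR_ge0 // ltW // psi_gt0.
- by rewrite [leRHS]mulrC ler_wpM2r // ltW // psi_gt0.
Qed.
Let sigma_le i j : (i <= j)%N -> sigma j <= sigma i.
Proof.
elim: j => [|j IH]; first by rewrite leqn0 => /eqP ->.
rewrite leq_eqVlt ltnS => /orP[/eqP -> //|/IH]; apply: le_trans.
by apply: (le_trans (sigma_S j)); have := sigma_gt0 j; lra.
Qed.
Let sigma_small e : 0 < e -> exists k, forall j, (k <= j)%N -> sigma j < e.
Proof.
move=> e0; have [k hk] := expR_small L_gt0 (divr_gt0 e0 (c_gt0 0)).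
exists k => j kj; have := hk j kj; rewrite ltr_pdivlMr //.
rewrite -(psi_Tseq psi_cont psi_oo psi_0) mulrC.
apply: le_lt_trans; rewrite ler_wpM2r //; first by rewrite ltW // psi_gt0.
by elim: (j) => // i; apply: le_trans.
Qed.

Variable J : nat.
Hypotheses (J0J : (J0 <= J)%N) (sigma_J : sigma J <= 2^-1).

Let separated k (S : seq V) := [/\ uniq S,
    (size (box A (sigma k / 4) (Tj k.+1 / 2)) <=
      size S * size (box A (4 * sigma k.+1) (Tj k.+1)))%N,
    {in S, forall y, `|top A y| <= sigma k / 4 /\ `|bot y| <= Tj k.+1 / 2} &
    {in S &, forall y y', y != y' -> 4 * sigma k.+1 < `|top A (y - y')|}].

Let tree_exists : exists S : nat -> seq V, forall k, separated k (S k).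
Proof.
suff /choice[S' hS'] : forall k, exists S', separated k S' by exists S'.
move=> k.
have [S hS] := box_separated A m_gt0 n_gt0 (sigma_gt0 k) (sigma_gt0 k.+1) (Tj_gt0 k.+1).
by exists S.
Qed.

Section fixed_tree.
Variable S : nat -> seq V.
Hypothesis hS : forall k, separated k (S k).
(** Below level [J] there is a single child, so that depth in the tree and level agree. [M] is the
    number of children guaranteed by [box_separated_size]. *)
Let Z k : seq V := if (k < J)%N then [:: 0] else S k.
Let M k : R := if (k < J)%N then 1 else expR (log_branching A psi L (c k) k) / K ^+ 2.

Let K_gt0 : 0 < K.
Proof. exact: lt_le_trans (count_cst_ge1 R n m_gt0). Qed.

Let M_gt0 k : 0 < M k.
Proof.
by rewrite /M; case: ifP => // _; apply: divr_gt0; [exact: expR_gt0|exact: exprn_gt0].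
Qed.

Let M_size k : M k <= (size (Z k))%:R.
Proof.
rewrite /M /Z; case: ifP => // _; have [_ szS _ _] := hS k.
rewrite (ler_pdivrMr _ _ (exprn_gt0 2 K_gt0)) [leRHS]mulrC expR_log_branching.
apply: (box_separated_size m_gt0 n_gt0 (sigma_gt0 k) _ (Tj_gt0 k.+1) szS).
rewrite sigma_gt0 /=; apply: ler_wpM2r; last exact: c_nonincr.
exact/ltW/psi_gt0.
Qed.

Let Z_uniq k : uniq (Z k).
Proof. by rewrite /Z; case: ifP => // _; case: (hS k). Qed.

Let is_branch (b : nat -> V) := forall k, b k \in Z k.

Let branchS b k : is_branch b -> (J <= k)%N -> b k \in S k.
Proof. by move=> bZ Jk; have := bZ k; rewrite /Z ltnNge Jk. Qed.

Let branch0 b k : is_branch b -> (k < J)%N -> b k = 0.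
Proof. by move=> bZ kJ; have := bZ k; rewrite /Z kJ inE => /eqP. Qed.

(** The tree is homogeneous: all vertices of depth k use the same displacements [Z k], and the
    lattice point at a vertex is the sum of the displacements leading to it. *)
Let partial (b : nat -> V) k : V := \sum_(j < k) b j.

Let partialS b k : partial b k.+1 = partial b k + b k.
Proof. by rewrite /partial big_ord_recr. Qed.

Let partialJ b : is_branch b -> partial b J = 0.
Proof. by move=> bZ; rewrite /partial big1 // => j _; exact: branch0. Qed.

(** By doubling, T_k + T_(k+1) / 2 <= T_(k+1). *)
Let bot_partial b k : is_branch b -> (J <= k)%N -> `|bot (partial b k)| <= Tj k.
Proof.
move=> bZ; elim: k => [|k IH].
  by rewrite leqn0 => /eqP J0'; rewrite /partial big_ord0 bot0 normr0 ltW.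
rewrite leq_eqVlt ltnS => /orP[/eqP <-|Jk].
  by rewrite partialJ // bot0 normr0 ltW.
rewrite partialS botD; apply: le_trans (ler_normD _ _) _.
have [_ _ hb _] := hS k; have [_ h1] := hb _ (branchS bZ Jk).
have := IH Jk; have := Tj_double (leq_trans J0J Jk); lra.
Qed.

(** A displacement at level k has top at most sigma_k / 4, and sigma_k / 4 + sigma_(k+1) / 2 <=
    sigma_k / 2. *)
Lemma branch_limit_exists (b : nat -> V) : exists x : 'cV[R]_m, is_branch b ->
  forall k, (J <= k)%N -> `|x - top A (partial b k)| <= sigma k / 2.
Proof.
have [bZ|] := pselect (is_branch b); last by exists 0.
have [||x hx] := @nested_limit R m (fun k => top A (partial b k))
  (fun k => sigma k / 2) J.
- by move=> k; rewrite divr_ge0 // ltW.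
- move=> k Jk; rewrite partialS topD [_ + top A (b k)]addrC addrK.
  have [_ _ hb _] := hS k; have [h1 _] := hb _ (branchS bZ Jk).
  have := sigma_S k; lra.
by exists x.
Qed.

Section fixed_limit.
Variable x : (nat -> V) -> 'cV[R]_m.
Hypothesis hx : forall b, is_branch b ->
  forall k, (J <= k)%N -> `|x b - top A (partial b k)| <= sigma k / 2.

Let x_small b : is_branch b -> `|x b| <= 4^-1.
Proof.
move=> bZ; have := hx bZ (leqnn J); rewrite partialJ // top0 subr0.
by have := sigma_J; lra.
Qed.

(** If l is the first index where the branches differ, their points of depth l+1 are more than 4
    sigma_(l+1) apart. Each limit is within sigma_(l+1) / 2 of its point, so the limits are more
    than 3 sigma_(l+1) >= sigma_k apart; being short vectors, they keep this distance on the
    torus. *)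
Let x_separated b b' k : is_branch b -> is_branch b' ->
  mdist (\pi_(torus R m)%qT (x b)) (\pi_(torus R m)%qT (x b')) < sigma k ->
  forall j, (j < k)%N -> b j = b' j.
Proof.
move=> bZ b'Z; rewrite ltNge => /negP h j jk; apply: contrapT => /eqP ne.
apply: h; have ex : exists i, b i != b' i by exists j.
case: (ex_minnP ex) => l nel lmin.
have lk : (l < k)%N by apply: leq_ltn_trans jk; exact: lmin.
have Jl : (J <= l)%N.
  by rewrite leqNgt; apply/negP => lJ; move: nel; rewrite !branch0 // eqxx.
have eqp : partial b l = partial b' l.
  apply: eq_bigr => i _; apply: contrapT => /eqP /lmin.
  by rewrite leqNgt ltn_ord.
apply: torus_mdist_pi; rewrite ?x_small //.
have [_ _ _ sep] := hS l.
have := sep _ _ (branchS bZ Jl) (branchS b'Z Jl) nel.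
have := hx bZ (leqW Jl); have := hx b'Z (leqW Jl).
rewrite !partialS eqp !topD.
set u := top A (partial b' l); rewrite topN.
move: (top A (b l)) (top A (b' l)) => y y' h1 h2 h3.
have := sigma_le lk; have := sigma_gt0 l.+1.
have : `|y - y'| <= `|x b - x b'| + `|x b - (u + y)| + `|x b' - (u + y')|.
  have -> : y - y' = (x b - x b') - (x b - (u + y)) + (x b' - (u + y')).
    by apply/matrixP => i i'; rewrite !mxE; ring.
  by apply: le_trans (ler_normD _ _) _; rewrite lerD2r; exact: ler_normB.
lra.
Qed.

Let x_approximable b k : is_branch b -> (J <= k)%N ->
  approximable A (\pi_(torus R m)%qT (x b)) (sigma k) (Tj k).
Proof.
move=> bZ Jk; have [p hp] := repr_pi_torus (x b).
exists (partial b k + shift_top n p); split.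
  rewrite topD top_shift hp.
  have -> : top A (partial b k) + intmx p - (x b + intmx p) =
      - (x b - top A (partial b k)).
    by apply/matrixP => i i'; rewrite !mxE; ring.
  by rewrite normrN; apply: le_trans (hx bZ Jk) _; have := sigma_gt0 k; lra.
by rewrite botD bot_shift addr0; apply: bot_partial.
Qed.

Variables (E : set (torus R m)) (lam s s' : R).
Hypothesis E_approx : forall b,
  (forall j, (J <= j)%N -> approximable A b (c j * psi (Tj j)) (Tj j)) -> E b.
Hypotheses (s_gt0 : 0 < s) (c_exp : forall k, c 0 * expR (- (k%:R * lam)) <= c k).
Hypothesis s_s' : s * (L + lam) + 2 * ln K <= s' * L.
Let total N := \sum_(0 <= j < N) log_branching A psi L (c j) j.
Hypothesis total_ge : exists N0, forall N, (N0 <= N)%N -> s' * (N%:R * L) <= total N.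

Let weight_from_J k : tree_weight M (J + k) <=
  expR ((J + k)%:R * (2 * ln K) - total (J + k) + total J).
Proof.
elim: k => [|k IH].
  rewrite addn0 subrK /tree_weight big1 // => [|j _].
    by rewrite -[leLHS]expR0 ler_expR !mulr_ge0 // ln_ge0 // count_cst_ge1.
  by rewrite /M ltn_ord invr1.
rewrite addnS; set N := (J + k)%N in IH *.
have -> : tree_weight M N.+1 = tree_weight M N * (M N)^-1.
  by rewrite /tree_weight big_ord_recr.
have -> : (M N)^-1 = expR (2 * ln K - log_branching A psi L (c N) N).
  rewrite /M ltnNge leq_addr /= invf_div expRD expRN mulr2n mulrDl mul1r expRD.
  by rewrite lnK ?posrE // expr2.
apply: le_trans (ler_wpM2r (expR_ge0 _) IH) _.
rewrite -expRD ler_expR /total big_nat_recr //= -natr1; lra.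
Qed.

(** The weight decays at least like e^(-k (s' L - 2 ln K)), while sigma_k^s is at least c_0^s e^(-k
    s (L + lam)); [s_s'] compares the exponents. Finitely many early levels are absorbed into the
    constant. The rate [lam] bounds the decay of c: 0 for constant c, ln 2 for [Sing]. *)
Let weight_le : exists2 C, 0 < C & forall k, tree_weight M k <= C * sigma k `^ s.
Proof.
have [N0 hN0] := total_ge.
have w0 k : 0 < tree_weight M k by apply: tree_weight_gt0.
have p0 k : 0 < sigma k `^ s by rewrite powR_gt0.
pose C1 := expR (total J) / c 0 `^ s.
have C10 : 0 < C1 by rewrite divr_gt0 ?expR_gt0 ?powR_gt0.
have tail k : (maxn J N0 <= k)%N -> tree_weight M k <= C1 * sigma k `^ s.
  rewrite geq_max => /andP[Jk N0k].
  have := weight_from_J (k - J); rewrite subnKC // => /le_trans; apply.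
  have h1 : c 0 `^ s * expR (- (k%:R * (L + lam)) * s) <= sigma k `^ s.
    rewrite -powR_expR -powRM ?expR_ge0 ?(ltW (c_gt0 0)) //.
    apply: ge0_ler_powR; rewrite ?nnegrE ?(ltW s_gt0) ?(ltW (sigma_gt0 _)) //.
      by rewrite mulr_ge0 ?expR_ge0 ?(ltW (c_gt0 0)).
    rewrite /sigma psi_Tseq // mulrDr opprD expRD [expR (- (k%:R * L)) * _]mulrC.
    by rewrite mulrA ler_wpM2r ?expR_ge0.
  apply: le_trans (ler_wpM2l (ltW C10) h1).
  rewrite /C1 [leRHS]mulrA divfK ?gt_eqF ?powR_gt0 // -expRD ler_expR.
  have := hN0 k N0k; have : k%:R * (s * (L + lam) + 2 * ln K) <= k%:R * (s' * L).
    by rewrite ler_wpM2l.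
  by rewrite /total; move: (\sum_(0 <= j < k) _) (\sum_(0 <= j < J) _) => a b; lra.
exists (C1 + \sum_(j < maxn J N0) tree_weight M j / sigma j `^ s).
  rewrite ltr_pwDl // sumr_ge0 // => j _; rewrite divr_ge0 ?(ltW (w0 _)) ?(ltW (p0 _)) //.
move=> k; have [/tail h|kN] := leqP (maxn J N0) k.
  apply: (le_trans h); rewrite ler_wpM2r ?(ltW (p0 _)) // lerDl sumr_ge0 // => j _.
  by rewrite divr_ge0 ?(ltW (w0 _)) ?(ltW (p0 _)).
rewrite (bigD1 (Ordinal kN)) //= addrCA -ler_pdivrMr // lerDl addr_ge0 ?(ltW C10) //.
rewrite sumr_ge0 // => j _; by rewrite divr_ge0 ?(ltW (w0 _)) ?(ltW (p0 _)).
Qed.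

Lemma hausdorff_dim_fixed_tree : (s%:E <= hausdorff_dim E)%E.
Proof.
have [C C0 hC] := weight_le.
apply: (@hausdorff_dim_cantor R _ _ Z M sigma
  (fun b => \pi_(torus R m)%qT (x b)) E s C (expR (- L) / 2)) => //.
- by rewrite divr_gt0 ?expR_gt0.
(* In the ratio e^(-L) / 2, the exponential comes from psi and the factor 1/2 from the possible
   halving of c. *)
- move=> k; rewrite /sigma psi_TseqS //.
  have h1 := c_half k; have h2 : 0 < expR (- L) * psi (Tj k).
    by rewrite mulr_gt0 ?expR_gt0 ?psi_gt0.
  have := ler_wpM2r (ltW h2) h1; lra.
- by move=> e e0; have [k hk] := sigma_small e0; exists k; exact: hk.
- by move=> b bZ; apply: E_approx => j; exact: x_approximable.
Qed.

End fixed_limit.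
End fixed_tree.

Lemma hausdorff_dim_ge_level (E : set (torus R m)) (lam s s' : R) :
  (forall b, (forall j, (J <= j)%N -> approximable A b (c j * psi (Tj j)) (Tj j)) ->
    E b) ->
  0 < s -> (forall k, c 0 * expR (- (k%:R * lam)) <= c k) ->
  s * (L + lam) + 2 * ln K <= s' * L ->
  (exists N0, forall N, (N0 <= N)%N ->
    s' * (N%:R * L) <= \sum_(0 <= j < N) log_branching A psi L (c j) j) ->
  (s%:E <= hausdorff_dim E)%E.
Proof.
move=> hE s0 hc hs ht; have [S hS] := tree_exists.
have [x hx] := choice (branch_limit_exists hS).
exact: (hausdorff_dim_fixed_tree hS hx hE s0 hc hs ht).
Qed.

End lower_bound.

(** * Slowly increasing exponents and conclusion *)

Section slow_sequence.
Variable t : nat -> nat.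

(* The first component increases at step N only if N has reached the threshold
   [t] of the next value and the second component, which records
   \sum_(j < N) (slow N - slow j), stays below 2 N. *)
Fixpoint slow_state (N : nat) : nat * nat :=
  if N is N'.+1 then
    let: (k, a) := slow_state N' in
    if (a <= N)%N && (t k.+1 <= N)%N then (k.+1, a + N)%N else (k, a)
  else (0, 0)%N.

Definition slow N := (slow_state N).1.

Lemma slow_stateS N : slow_state N.+1 =
  if ((slow_state N).2 <= N.+1)%N && (t (slow N).+1 <= N.+1)%N
  then ((slow N).+1, (slow_state N).2 + N.+1)%N else slow_state N.
Proof. by rewrite /slow /=; case: (slow_state N). Qed.

Lemma slow_S N : (slow N <= slow N.+1 <= (slow N).+1)%N.
Proof.
rewrite {2 3}/slow slow_stateS; case: ifP => _ /=; first by rewrite leqnSn leqnn.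
by rewrite leqnn leqnSn.
Qed.

Lemma slow_homo i j : (i <= j)%N -> (slow i <= slow j)%N.
Proof.
elim: j => [|j IH]; first by rewrite leqn0 => /eqP ->.
rewrite leq_eqVlt ltnS => /orP[/eqP -> //|/IH /leq_trans]; apply.
by case/andP: (slow_S j).
Qed.

Lemma slow_le N : (slow N <= N)%N.
Proof.
elim: N => // N IH; have /andP[_ h] := slow_S N; exact: leq_trans h _.
Qed.

Lemma slow_threshold N : (0 < slow N)%N -> (t (slow N) <= N)%N.
Proof.
elim: N => // N IH; rewrite [slow N.+1]/slow slow_stateS.
case: ifP => [/andP[_ h] _ //|_ /IH h]; exact: leq_trans h _.
Qed.

(** An increase at step N+1 raises each of the N+1 differences by one. It happens only if the
    previous total is at most N+1, so the new total is at most 2 (N+1). *)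
Lemma slow_defect N : (\sum_(0 <= j < N) (slow N - slow j) <= 2 * N)%N.
Proof.
suff h : forall N, (slow_state N).2 = (\sum_(0 <= j < N) (slow N - slow j))%N /\
    ((slow_state N).2 <= 2 * N)%N by have [<- ] := h N.
elim=> [|k [IH1 IH2]]; first by rewrite big_nil.
rewrite [slow k.+1]/slow slow_stateS; case: ifP => [/andP[h _]|_] /=.
  split; last by rewrite mulnS mul2n -addnn in IH2 *; lia.
  rewrite IH1 big_nat_recr //= subSnn.
  have -> : (\sum_(0 <= j < k) ((slow k).+1 - slow j) =
      \sum_(0 <= j < k) ((slow k - slow j) + 1))%N.
    apply: eq_big_nat => j /andP[_ jk]; rewrite subSn ?addn1 //.
    exact/slow_homo/ltnW.
  by rewrite big_split /= sum_nat_const_nat subn0 muln1 -addnA addn1.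
split; last by apply: leq_trans IH2 _; rewrite leq_mul2l leqnSn.
by rewrite IH1 big_nat_recr //= subnn addn0.
Qed.

(** If the value stopped increasing, the whole state would be constant, and both tests would succeed
    once N exceeds the recorded total and the next threshold. *)
Lemma slow_unbounded k : exists j0, forall j, (j0 <= j)%N -> (k <= slow j)%N.
Proof.
suff [j0 h] : exists j0, (k <= slow j0)%N.
  by exists j0 => j /slow_homo; exact: leq_trans.
elim: k => [|k [j0 kj0]]; first by exists 0%N.
apply: contrapT => /forallNP h.
have eqk j : (j0 <= j)%N -> slow j = k.
  move=> j0j; apply/eqP; rewrite eqn_leq (leq_trans kj0 (slow_homo j0j)) andbT.
  by rewrite leqNgt; apply/negP; exact: h.
have sta i : slow_state (j0 + i) = slow_state j0.
  elim: i => [|i IH]; first by rewrite addn0.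
  rewrite addnS slow_stateS; case: ifP => // hi; exfalso.
  have := eqk (j0 + i).+1; rewrite {1}/slow slow_stateS hi /=.
  rewrite (eqk (j0 + i)%N (leq_addr _ _)) => /(_ _)/eqP.
  by rewrite -addnS leq_addr gtn_eqF // => /(_ isT).
pose N := ((slow_state j0).2 + t k.+1)%N.
have := eqk (j0 + N).+1; rewrite /slow slow_stateS sta eqk ?leq_addr //.
rewrite ifT /=.
  move=> /(_ _)/eqP; rewrite gtn_eqF // => h'; suff : false by [].
  by apply: h'; rewrite -addnS leq_addr.
apply/andP; split; rewrite /N; lia.
Qed.

End slow_sequence.

Lemma ln_le_mul (R : realType) (x y k : R) : 0 < x -> 0 < y -> 0 < k ->
  x <= k ^+ 2 * y -> ln x <= 2 * ln k + ln y.
Proof.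
move=> x0 y0 k0 h; have k2 : 0 < k ^+ 2 by exact: exprn_gt0.
have -> : 2 * ln k = ln (k ^+ 2) by rewrite lnXn // mulr_natl.
by rewrite -lnM ?posrE // ler_ln ?posrE // mulr_gt0.
Qed.

Lemma dist_le_sym (R : realDomainType) (a b e : R) :
  a <= e + b -> b <= e + a -> `|a - b| <= e.
Proof. by move=> h1 h2; rewrite ler_norml; apply/andP; split; lra. Qed.

Lemma sub_le_of_dist (R : realDomainType) (a b a' b' e : R) :
  `|a - b| <= 2 * e -> `|a' - b'| <= 2 * e -> a - a' <= b - b' + 4 * e.
Proof. by rewrite !ler_norml => /andP[_ h1] /andP[h2 _]; lra. Qed.

(** * Comparison of pressures and dimensions *)

Section assembly.
Variables (R : realType) (m n : nat) (A : 'M[R]_(m, n)) (psi : R -> R).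
Hypotheses (m_gt0 : (0 < m)%N) (n_gt0 : (0 < n)%N).
Hypothesis psi_gt0 : forall T : R, 0 < T -> 0 < psi T.
Hypothesis psi_cont : {in `]0, +oo[, continuous psi}.
Hypothesis psi_decr : forall S T : R, 0 < S -> S < T -> psi T < psi S.
Hypothesis psi_oo : psi T @[T --> +oo] --> (0 : R).
Hypothesis psi_0 : psi T @[T --> 0^'+] --> +oo.
Hypothesis psi_lqm : lower_quasimultiplicative psi.
Local Notation K := (count_cst R m n).
Local Notation Tj L := (Tseq psi L).
Local Notation dimD c := (hausdorff_dim (D A (scale c psi))).

Lemma ln_count_cst_ge0 : 0 <= ln K.
Proof. by rewrite ln_ge0 // count_cst_ge1. Qed.

Lemma log_branchingE L c j : log_branching A psi L c j =
  ln (Nprod A (c * psi (Tj L j)) (Tj L j.+1)) -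
  ln (Nprod A (c * psi (Tj L j.+1)) (Tj L j.+1)).
Proof. by rewrite log_branching.unlock ln_div ?posrE ?Nprod_gt0. Qed.

Lemma ln_Nprod_half r Q : 0 < r -> 0 < Q ->
  `|ln (Nprod A (r / 2) Q) - ln (Nprod A r Q)| <= 2 * ln K.
Proof.
move=> r0 Q0; have K0 : 0 < K by apply: lt_le_trans (count_cst_ge1 R n m_gt0).
apply: dist_le_sym; apply: ln_le_mul; rewrite ?Nprod_gt0 //.
  exact: Nprod_half_ge.
exact: Nprod_half_le.
Qed.

(** The logarithms of numerator and denominator each change by at most 2 ln K. *)
Lemma log_branching_half L c j : 0 < L -> 0 < c ->
  log_branching A psi L (c / 2) j <= log_branching A psi L c j + 4 * ln K.
Proof.
move=> L0 c0; have T0 i : 0 < Tj L i by apply: Tseq_gt0.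
have h i : `|ln (Nprod A (c / 2 * psi (Tj L i)) (Tj L j.+1)) -
    ln (Nprod A (c * psi (Tj L i)) (Tj L j.+1))| <= 2 * ln K.
  by rewrite mulrAC; apply: ln_Nprod_half; rewrite ?mulr_gt0 ?psi_gt0.
rewrite (log_branchingE L (c / 2)) (log_branchingE L c).
exact: (sub_le_of_dist (h j) (h j.+1)).
Qed.

Lemma log_branching_pow2 L i l j : 0 < L -> (i <= l)%N ->
  log_branching A psi L (2^-1 ^+ l) j <=
  log_branching A psi L (2^-1 ^+ i) j + (l - i)%:R * (4 * ln K).
Proof.
move=> L0; elim: l => [|l IH].
  by rewrite leqn0 => /eqP ->; rewrite subn0 mul0r addr0.
rewrite leq_eqVlt ltnS => /orP[/eqP ->|il]; first by rewrite subnn mul0r addr0.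
have c0 : 0 < (2^-1 : R) ^+ l by rewrite exprn_gt0 // invr_gt0.
have := log_branching_half j L0 c0; rewrite -exprSr => h.
rewrite subSn // -[(l - i).+1%:R]natr1 mulrDl mul1r addrA; apply: (le_trans h).
by rewrite lerD2r; exact: IH.
Qed.

Lemma hausdorff_dim_ge : exists2 L0 : R, 1 <= L0 & forall L, L0 <= L ->
  forall (c : nat -> R) (E : set (torus R m)) (lam s s' : R),
  (forall j, 0 < c j) -> (forall j, c j.+1 <= c j) -> (forall j, c j / 2 <= c j.+1) ->
  (forall J b, (forall j, (J <= j)%N ->
      approximable A b (c j * psi (Tj L j)) (Tj L j)) -> E b) ->
  0 < s -> (forall k, c 0 * expR (- (k%:R * lam)) <= c k) ->
  s * (L + lam) + 2 * ln K <= s' * L ->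
  (exists N0, forall N, (N0 <= N)%N ->
    s' * (N%:R * L) <= \sum_(0 <= j < N) log_branching A psi L (c j) j) ->
  (s%:E <= hausdorff_dim E)%E.
Proof.
have [L1 L10 hL1] := Tseq_double psi_gt0 psi_cont psi_decr psi_oo psi_0 psi_lqm.
exists (Num.max 1 L1); first by rewrite le_max lexx.
move=> L; rewrite ge_max => /andP[L1' LL1] c E lam s s' c0 cS cH hE s0 hc hs ht.
have Lgt0 : 0 < L by apply: lt_le_trans L1'.
have [J0 hJ0] := hL1 L LL1.
(* The starting level must be past the onset of doubling and have scale at most 1/2, so that the
   Cantor set embeds isometrically enough in the torus. *)
have c00 : 0 < 2^-1 / c 0 by rewrite divr_gt0 // invr_gt0.
have [J1 hJ1] := expR_small Lgt0 c00.
pose J := maxn J0 J1.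
have sJ : c J * psi (Tj L J) <= 2^-1.
  have := hJ1 J (leq_maxr _ _); rewrite ltr_pdivlMr // => /ltW; apply: le_trans.
  rewrite (psi_Tseq psi_cont psi_oo psi_0) mulrC ler_wpM2l ?expR_ge0 //.
  by elim: (J) => // i; apply: le_trans.
exact: (hausdorff_dim_ge_level m_gt0 n_gt0 psi_gt0 psi_cont psi_oo psi_0
  L1' hJ0 c0 cS cH (leq_maxl J0 J1) sJ (hE J) s0 hc hs ht).

Qed.

(** The Cantor construction is run with constant c and lam = 0; the factor e^L is the price of
    passing from the levels T_j to all T. *)
Lemma pressure_le_dim : exists2 L0 : R, 1 <= L0 & forall L, L0 <= L ->
  forall c, 0 < c ->
  (pressure A psi L c <= dimD (c * expR L) + (2 * ln K / L)%:E)%E.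
Proof.
have [L0 L01 hL0] := hausdorff_dim_ge; exists L0 => // L LL0 c c0.
have Lgt0 : 0 < L by apply: lt_le_trans (le_trans L01 LL0).
rewrite leNgt; apply/negP.
have := hausdorff_dim_ge0 (D A (scale (c * expR L) psi)).
case dE : (dimD (c * expR L)) => [delta| |] //; last first.
  by move=> _; rewrite addye // => /lt_geF; rewrite leey.
rewrite lee_fin -EFinD => delta0 hlt.
have [s' ds' s'P] : exists2 s', delta + 2 * ln K / L < s' &
    (s'%:E < pressure A psi L c)%E.
  move: hlt; case: (pressure A psi L c) => [p| |] //; last first.
    by exists (delta + 2 * ln K / L + 1); rewrite ?ltry //; lra.
  rewrite lte_fin => h; exists ((delta + 2 * ln K / L + p) / 2); rewrite ?lte_fin; lra.
have : ((s' - 2 * ln K / L)%:E <= dimD (c * expR L))%E.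
  apply: (hL0 L LL0 (fun=> c) (D A (scale (c * expR L) psi)) 0 _ s').
  - by [].
  - by [].
  - by move=> _; rewrite ler_pdivrMr // ler_pMr // ler1n.
  - move=> J b hb; apply: (approximable_D psi_gt0 psi_cont psi_decr psi_oo psi_0 Lgt0
      (c' := fun=> c) (J := J)) => // j /hb.
    by rewrite (psi_Tseq psi_cont psi_oo psi_0).
  - by rewrite subr_gt0; apply: le_lt_trans ds'; rewrite lerDr.
  - by move=> k; rewrite mulr0 oppr0 expR0 mulr1.
  - by rewrite addr0 mulrBl divfK ?gt_eqF // subrK.
  - exact: pressure_gt.
by rewrite dE lee_fin; apply/negP; rewrite -ltNge ltrBrDr.
Qed.

Lemma D_mono c c' : c <= c' -> D A (scale c psi) `<=` D A (scale c' psi).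
Proof.
move=> cc' b [M [Mr hM]]; exists (Num.max M 0).
split; first exact: num_real.
move=> T; rewrite gt_max => /andP[MT T0]; have [p [q [h1 h2]]] := hM T MT.
exists p, q; split => //; apply: (le_trans h1).
by rewrite /scale ler_wpM2r // ltW // psi_gt0.
Qed.

Definition infdim := ereal_inf [set dimD c | c in [set c : R | 0 < c]].
Definition supdim := ereal_sup [set dimD c | c in [set c : R | 0 < c]].

(** Multiplication of c by e^L or e^(-L) maps the positive reals onto themselves, so the shift
    disappears under the infimum and the supremum. *)
Lemma pressure_bounds : exists2 L0 : R, 1 <= L0 & forall L, L0 <= L ->
  [/\ (infdim <= inf_pressure A psi L + (2 * ln K / L)%:E)%E,
      (inf_pressure A psi L <= infdim + (2 * ln K / L)%:E)%E,
      (supdim <= sup_pressure A psi L + (2 * ln K / L)%:E)%E &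
      (sup_pressure A psi L <= supdim + (2 * ln K / L)%:E)%E].
Proof.
have [L0 L01 hL0] := pressure_le_dim; exists L0 => // L LL0.
have Lgt0 : 0 < L by apply: lt_le_trans (le_trans L01 LL0).
have lnK0 := ln_count_cst_ge0.
have up c : 0 < c -> (dimD c <= pressure A psi L c + (2 * ln K / L)%:E)%E.
  move=> c0; apply: le_trans (hausdorff_dim_D_le A m_gt0 n_gt0 psi_gt0 psi_cont
    psi_decr psi_oo psi_0 Lgt0 c0) _.
  by rewrite leeD2l // lee_fin ler_wpM2r ?invr_ge0 ?(ltW Lgt0) //; lra.
have low c : 0 < c ->
    (pressure A psi L (c * expR (- L)) <= dimD c + (2 * ln K / L)%:E)%E.
  move=> c0; have := hL0 L LL0 (c * expR (- L)) (mulr_gt0 c0 (expR_gt0 _)).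
  by rewrite -mulrA -expRD addNr expR0 mulr1.
split.
- rewrite -leeBlDr //; apply: le_ereal_inf_tmp => _ [c c0 <-].
  by rewrite leeBlDr //; apply: le_trans (up c c0); apply: ereal_inf_lbound; exists c.
- rewrite -leeBlDr //; apply: le_ereal_inf_tmp => _ [c c0 <-].
  rewrite leeBlDr //; apply: le_trans (low c c0); apply: ereal_inf_lbound.
  by exists (c * expR (- L)) => //=; rewrite mulr_gt0 ?expR_gt0.
- apply: ge_ereal_sup => _ [c c0 <-]; apply: (le_trans (up c c0)).
  by rewrite leeD2r //; apply: ereal_sup_ubound; exists c.
- apply: ge_ereal_sup => _ [c c0 <-]; apply: (le_trans (hL0 L LL0 c c0)).
  rewrite leeD2r //; apply: ereal_sup_ubound; exists (c * expR L) => //=.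
  by rewrite mulr_gt0 ?expR_gt0.
Qed.

Lemma cvg_const_div (a : R) : (a / L)%:E @[L --> +oo] --> (0 : \bar R).
Proof.
apply: cvg_EFin; first by near=> L.
apply/cvgrPdist_le => e e0; near=> L.
have L0 : 0 < L by near: L; exact: nbhs_pinfty_gt.
rewrite /= sub0r normrN normrM (gtr0_norm (_ : 0 < L^-1)) ?invr_gt0 //.
rewrite ler_pdivrMr // mulrC -ler_pdivrMr //.
Unshelve. all: by end_near.
Qed.

Lemma cvg_squeeze_div (f : R -> \bar R) (x : \bar R) (a L0 : R) :
  (forall L, L0 <= L -> (x <= f L + (a / L)%:E)%E /\ (f L <= x + (a / L)%:E)%E) ->
  f L @[L --> +oo] --> x.
Proof.
move=> h.
apply: (@squeeze_cvge _ _ _ _ (fun L => (x - (a / L)%:E)%E) f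
  (fun L => (x + (a / L)%:E)%E)).
- near=> L; have [h1 h2] : (x <= f L + (a / L)%:E)%E /\ (f L <= x + (a / L)%:E)%E.
    by apply: h; near: L; apply: nbhs_pinfty_ge; exact: num_real.
  by rewrite leeBlDr // h1 h2.
- rewrite -[X in _ --> X]adde0 -[X in (x + X)%E]oppe0; apply: cvgeD.
  + by rewrite oppe0 fin_num_adde_defl.
  + exact: cvg_cst.
  + by apply: cvgeN; exact: cvg_const_div.
- rewrite -[X in _ --> X]adde0; apply: cvgeD; first by rewrite fin_num_adde_defl.
    exact: cvg_cst.
  exact: cvg_const_div.
Unshelve. all: by end_near.
Qed.

Lemma inf_pressure_cvg : inf_pressure A psi L @[L --> +oo] --> infdim.
Proof.
have [L0 _ h] := pressure_bounds.
by apply: (@cvg_squeeze_div _ _ (2 * ln K) L0) => L /h[].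
Qed.

Lemma sup_pressure_cvg : sup_pressure A psi L @[L --> +oo] --> supdim.
Proof.
have [L0 _ h] := pressure_bounds.
by apply: (@cvg_squeeze_div _ _ (2 * ln K) L0) => L /h[].
Qed.

Lemma PminusE : Pminus A psi = infdim.
Proof. by apply/cvg_lim => //; exact: inf_pressure_cvg. Qed.

Lemma PplusE : Pplus A psi = supdim.
Proof. by apply/cvg_lim => //; exact: sup_pressure_cvg. Qed.

Lemma hausdorff_dim_U : hausdorff_dim (U A psi) = supdim.
Proof.
apply/eqP; rewrite eq_le; apply/andP; split; last first.
  apply: ge_ereal_sup => _ [c c0 <-]; apply: hausdorff_dim_subset => b hb.
  by exists c.
apply: (@le_trans _ _ (hausdorff_dim (\bigcup_k D A (scale k.+1%:R psi)))).
  apply: hausdorff_dim_subset => b [c c0 hb].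
  exists (Num.trunc c) => //; apply: D_mono hb; exact/ltW/truncnS_gt.
apply: hausdorff_dim_bigcup => k; apply: ereal_sup_ubound.
by exists k.+1%:R => //=; rewrite ltr0n.
Qed.

Lemma hausdorff_dim_Sing : hausdorff_dim (Sing A psi) = infdim.
Proof.
apply/eqP; rewrite eq_le; apply/andP; split.
  apply: le_ereal_inf_tmp => _ [c c0 <-]; apply: hausdorff_dim_subset => b.
  by apply.
rewrite leNgt; apply/negP.
have := hausdorff_dim_ge0 (Sing A psi).
case dE : (hausdorff_dim (Sing A psi)) => [delta| |] //; last first.
  by move=> _; rewrite ltNge leey.
rewrite lee_fin => delta0 hlt.
have lnK0 := ln_count_cst_ge0.
have [s2 ds2 s2X] : exists2 s2, delta < s2 & (s2%:E < infdim)%E.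
  move: hlt; case: infdim => [p| |] //; last first.
    by exists (delta + 1); rewrite ?ltry //; lra.
  by rewrite lte_fin => h; exists ((delta + p) / 2); rewrite ?lte_fin; lra.
pose s := (delta + s2) / 2.
have [L0 L01 hL0] := hausdorff_dim_ge.
have ln2 : 0 <= ln 2 :> R by rewrite ln_ge0 // ler1n.
have ss2 : 0 < s2 - s by rewrite /s; lra.
(* For L >= L1 one has s (L + ln 2) + 2 ln K <= (s2 - 8 ln K / L) L, the exponent condition of
   [hausdorff_dim_ge]. *)
pose L1 := (s * ln 2 + 10 * ln K) / (s2 - s).
have [L [LL0 LL1 s2L]] : exists L, [/\ L0 <= L, L1 <= L &
    (s2%:E < inf_pressure A psi L)%E].
  have h : \forall L \near +oo, [/\ L0 <= L, L1 <= L &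
      (s2%:E < inf_pressure A psi L)%E].
    have hX : nbhs infdim [set y | (s2%:E < y)%E].
      by apply: open_nbhs_nbhs; split => //; exact: open_ereal_gt_ereal.
    near=> L; split.
    - by near: L; apply: nbhs_pinfty_ge; exact: num_real.
    - by near: L; apply: nbhs_pinfty_ge; exact: num_real.
    - by near: L; exact: (inf_pressure_cvg hX).
  by have [L hL] := filter_ex h; exists L.
have Lgt0 : 0 < L by apply: lt_le_trans (le_trans L01 LL0).
have ev k : exists N0, forall N, (N0 <= N)%N ->
    s2 * (N%:R * L) <= branching_sum A psi L (2^-1 ^+ k) N.
  apply: pressure_gt => //; apply: (lt_le_trans s2L).
  by apply: ereal_inf_lbound; exists (2^-1 ^+ k) => //=; rewrite exprn_gt0 // invr_gt0.
(* [t k] is a time from which the averages for c = 2^(-k) are at least [s2]; the slow sequence waits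
   for it before taking the value k. *)
have [t ht] := choice ev.
pose c j : R := 2^-1 ^+ slow t j.
have half01 : 0 <= (2^-1 : R) <= 1 by apply/andP; split; lra.
have c0 j : 0 < c j by rewrite exprn_gt0 // invr_gt0.
have : (s%:E <= hausdorff_dim (Sing A psi))%E.
  apply: (hL0 L LL0 c (Sing A psi) (ln 2) s (s2 - 8 * ln K / L)) => //.
  - move=> j; have /andP[h1 h2] := slow_S t j.
    by apply: ler_wiXn2l => //; case/andP: half01.
  - move=> j; have /andP[h1 h2] := slow_S t j.
    rewrite /c -exprSr; apply: ler_wiXn2l => //; by case/andP: half01.
  - move=> J b hb e /= e0.
    have [j1 hj1] := expR_small (ltr01 : 0 < (1 : R)) (divr_gt0 e0 (expR_gt0 L)).
    have ec : 0 < e / expR L by rewrite divr_gt0 ?expR_gt0.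
    have [k hk] : exists k, (2^-1 : R) ^+ k <= e / expR L.
      exists (Num.bound (e / expR L)^-1).
      rewrite exprVn -[leRHS]invrK lef_pV2 ?posrE ?exprn_gt0 ?invr_gt0 //.
      apply/ltW; apply: lt_trans (archi_boundP _) _; first by rewrite invr_ge0 ltW.
      by rewrite -natrX ltr_nat ltn_expl.
    have [j0 hj0] := slow_unbounded t k.
    apply: (approximable_D psi_gt0 psi_cont psi_decr psi_oo psi_0 Lgt0
      (c' := c) (J := maxn J j0)) => j; rewrite geq_max => /andP[Jj j0j].
      by have := hb j Jj; rewrite (psi_Tseq psi_cont psi_oo psi_0).
    rewrite -ler_pdivlMr ?expR_gt0 //; apply: le_trans hk.
    by apply: ler_wiXn2l; [case/andP: half01|case/andP: half01|exact: hj0].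
  - by rewrite /s; lra.
  (* Since [slow t k] <= k, c k is at least 2^(-k), whence the rate ln 2. *)
  - move=> k; have -> : c 0 = 1 by rewrite /c /slow /= expr0.
    rewrite mul1r expRN expRM_natl lnK ?posrE // -exprVn.
    by apply: ler_wiXn2l; [case/andP: half01|case/andP: half01|exact: slow_le].
  - rewrite mulrBl divfK ?gt_eqF //.
    have : (s2 - s) * L1 <= (s2 - s) * L by rewrite ler_pM2l.
    rewrite /L1 mulrC divfK ?gt_eqF //; lra.
  have [j1 hj1] := slow_unbounded t 1; exists j1 => N j1N.
  have tN : (t (slow t N) <= N)%N by apply: slow_threshold; exact: hj1.
  have h1 := ht (slow t N) N tN.
  (* The sum with varying c is compared with the one for the fixed final value c_N. Each halving
     costs 4 ln K per term, and [slow_defect] bounds the total cost by 8 N ln K. *)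
  have h2 : branching_sum A psi L (2^-1 ^+ slow t N) N <=
      \sum_(0 <= j < N) (log_branching A psi L (c j) j +
        (slow t N - slow t j)%:R * (4 * ln K)).
    apply: ler_sum_nat => j /andP[_ jN]; apply: log_branching_pow2 => //.
    exact/slow_homo/ltnW.
  move: h2; rewrite big_split /= -mulr_suml -natr_sum => h2.
  have h3 : (\sum_(0 <= j < N) (slow t N - slow t j))%:R * (4 * ln K) <=
      (2 * N)%:R * (4 * ln K).
    by apply: ler_wpM2r; [exact: mulr_ge0|rewrite ler_nat; exact: slow_defect].
  rewrite natrM in h3.
  have -> : (s2 - 8 * ln K / L) * (N%:R * L) =
      s2 * (N%:R * L) - 8 * ln K * N%:R.
    by rewrite mulrBl; congr (_ - _); rewrite mulrCA divfK ?gt_eqF // mulrC.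
  move: h1 h2 h3; move: (branching_sum _ _ _ _ _) (\sum_(0 <= j < N) _) => u v.
  lra.
rewrite dE lee_fin; apply/negP; rewrite -ltNge /s; lra.
Unshelve. all: by end_near.
Qed.

End assembly.

Theorem theorem1p2 (R : realType) (m n : nat) (m_gt0 : (0 < m)%N)
    (n_gt0 : (0 < n)%N) (A : 'M[R]_(m, n)) (psi : R -> R)
    (psi_gt0 : forall T : R, 0 < T -> 0 < psi T)
    (psi_cont : {in `]0, +oo[, continuous psi})
    (psi_decr : forall S T : R, 0 < S -> S < T -> psi T < psi S)
    (psi_lqm : lower_quasimultiplicative psi)
    (psi_oo : psi T @[T --> +oo] --> (0 : R))
    (psi_0 : psi T @[T --> 0^'+] --> +oo) :
  ([/\ cvg (inf_pressure A psi L @[L --> +oo]),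
       cvg (sup_pressure A psi L @[L --> +oo]),
       hausdorff_dim (Sing A psi) =
         ereal_inf [set hausdorff_dim (D A (scale c psi))
                   | c in [set c : R | 0 < c]] /\
       ereal_inf [set hausdorff_dim (D A (scale c psi))
                 | c in [set c : R | 0 < c]] = Pminus A psi &
       hausdorff_dim (U A psi) =
         ereal_sup [set hausdorff_dim (D A (scale c psi))
                   | c in [set c : R | 0 < c]] /\
       ereal_sup [set hausdorff_dim (D A (scale c psi))
                 | c in [set c : R | 0 < c]] = Pplus A psi])
  /\
  (((forall c c' : R, 0 < c -> 0 < c' ->
       hausdorff_dim (D A (scale c psi)) = hausdorff_dim (D A (scale c' psi)))
    <-> Pminus A psi = Pplus A psi)
   /\
   (Pminus A psi = Pplus A psi ->
    [/\ hausdorff_dim (D A psi) = hausdorff_dim (Sing A psi),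
        hausdorff_dim (Sing A psi) = hausdorff_dim (U A psi),
        hausdorff_dim (U A psi) = Pminus A psi,
        Pminus A psi = Pplus A psi &
        pressure A psi L 1 @[L --> +oo] --> Pplus A psi])).
Proof.
have infE := PminusE A m_gt0 n_gt0 psi_gt0 psi_cont psi_decr psi_oo psi_0 psi_lqm.
have supE := PplusE A m_gt0 n_gt0 psi_gt0 psi_cont psi_decr psi_oo psi_0 psi_lqm.
have infC : inf_pressure A psi L @[L --> +oo] --> infdim A psi.
  exact: inf_pressure_cvg.
have supC : sup_pressure A psi L @[L --> +oo] --> supdim A psi.
  exact: sup_pressure_cvg.
have SingE := hausdorff_dim_Sing A m_gt0 n_gt0 psi_gt0
  psi_cont psi_decr psi_oo psi_0 psi_lqm.
have UE := hausdorff_dim_U A psi_gt0.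
have between c : 0 < c -> (infdim A psi <= hausdorff_dim (D A (scale c psi)))%E /\
    (hausdorff_dim (D A (scale c psi)) <= supdim A psi)%E.
  move=> c0; split; first by apply: ereal_inf_lbound; exists c.
  by apply: ereal_sup_ubound; exists c.
split.
  split; [by apply/cvg_ex; exists (infdim A psi)|by apply/cvg_ex; exists (supdim A psi)|..].
  - by rewrite SingE infE.
  - by rewrite UE supE.
split; first split.
- move=> indep; rewrite infE supE; apply/eqP; rewrite eq_le; apply/andP; split.
    by have [h1 h2] := between 1 ltr01; exact: le_trans h1 h2.
  apply: ge_ereal_sup => _ [c c0 <-]; apply: le_ereal_inf_tmp => _ [c' c'0 <-].
  by rewrite (indep c c').
- rewrite infE supE => eqX c c' c0 c'0.
  have const d : 0 < d -> hausdorff_dim (D A (scale d psi)) = infdim A psi.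
    move=> d0; have [h1 h2] := between d d0; apply/eqP.
    by rewrite eq_le h1 andbT eqX.
  by rewrite !const.
move=> eqP'; rewrite SingE UE infE supE.
have eqX : infdim A psi = supdim A psi by rewrite -infE -supE.
have psi1 : scale 1 psi = psi by apply/funext => T; rewrite /scale mul1r.
split => //.
- have [h1 h2] := between 1 ltr01; rewrite psi1 in h1 h2.
  by apply/eqP; rewrite eq_le h1 andbT eqX.
- rewrite -eqX in supC *.
  (* The pressure at c = 1 lies between the infimum and the supremum over c, which now have the same
     limit. *)
  apply: (@squeeze_cvge _ _ _ _ (inf_pressure A psi) _ (sup_pressure A psi)) => //.
  apply: nearW => L; apply/andP; split.
    by apply: ereal_inf_lbound; exists 1 => //=.
  by apply: ereal_sup_ubound; exists 1 => //=.
Qed.
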